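(* Let $k\in\mathbb N$ and let $E=[E_n]_{n\in\mathbb N}$ be a Montel Fréchet space which admits a continuous norm and has an unconditional $k$-FDD with blocks $(E_n)_{n\in\mathbb N}$. Then any sequence $(x_n)_{n\in\mathbb N}$ with $x_n\in E_n$ for all $n\in\mathbb N$ has a naturally complemented subsequence. Furthermore, there exists an infinite subset $M$ of $\mathbb N$ such that $E_M$ is (isomorphic to) $\lambda(A)$ for some nuclear Köthe space $\lambda(A)$.
   Context: Spaces are over $\mathbb R$ or $\mathbb C$. A Fréchet space is a complete metrizable locally convex space. A finite dimensional decomposition (FDD) of $E$ is a sequence $(A_n)_{n\in\mathbb N}$ of continuous linear operators $A_n:E\to E$ with $\dim A_n(E)<\infty$, $A_nA_m=\delta_{mn}A_n$, and $x=\sum_{n=1}^\infty A_nx$ for all $x\in E$; one writes $E_n:=A_n(E)$, and the blocks $E_n$ are understood to be nonzero. It is a $k$-FDD if $\dim E_n\le k$ for all $n$, and it is unconditional if all the series $\sum_n A_nx$ converge unconditionally. $[\,\cdot\,]$ denotes closed linear span, and for an infinite subset $M\subseteq\mathbb N$, $E_M:=\overline{\bigoplus_{n\in M}E_n}$. A subspace $G$ of $E$ is a step subspace if $G=\overline{\bigoplus_{n\in\mathbb N}(G\cap E_n)}$. A step subspace $K$ of $E$ is naturally complemented if there is a continuous linear projection $P:E\to E$ with $P(E)=K$ that commutes with every $A_n$. A subsequence $(x_n)_{n\in M}$ ($M$ an infinite subset of $\mathbb N$) is naturally complemented if the step subspace $[x_n]_{n\in M}$ is naturally complemented in $E$. For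 a Köthe matrix $A=(a_{j,m})_{j,m\in\mathbb N}$ (i.e. $0\le a_{j,m}\le a_{j,m+1}$ and for each $j$ some $a_{j,m}>0$), the Köthe space $\lambda(A)$ is the space of scalar sequences $(\xi_j)$ with $\sum_j|\xi_j|a_{j,m}<\infty$ for all $m$, with the topology given by these seminorms. *)

(* Defs.v *)
From HB Require Import structures.
From mathcomp Require Import all_boot all_order all_algebra.
From mathcomp Require Import complex.
From mathcomp Require Import all_classical all_reals all_analysis.

Set Implicit Arguments.
Unset Strict Implicit.
Unset Printing Implicit Defensive.

Import Order.TTheory GRing.Theory Num.Theory.
Import numFieldNormedType.Exports.

Local Open Scope classical_set_scope.
Local Open Scope ring_scope.
Local Open Scope complex_scope.

Variant scalars := RealScalars | ComplexScalars.

Definition scalar_field (R : realType) (s : scalars) : numFieldType :=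
  match s with RealScalars => R | ComplexScalars => R[i] end.

(* The norm of [R[i]] takes its values in [R[i]]; [modulus] is its real-valued
   version, so that seminorms can be real-valued over both fields. *)
Definition modulus (R : realType) (s : scalars) : scalar_field R s -> R :=
  match s return scalar_field R s -> R with
  | RealScalars => fun x => `|x|
  | ComplexScalars => fun z => complex.Re `|z|
  end.

Section modulus_theory.
Context (R : realType) (s : scalars).
Local Notation K := (scalar_field R s).
Implicit Types x y : K.

Lemma modulus_ge0 x : 0 <= modulus x.
Proof.
case: s x => x /=; first exact: normr_ge0.
by have := normr_ge0 x; rewrite lecE /= => /andP[].
Qed.

Lemma modulusD x y : modulus (x + y) <= modulus x + modulus y.
Proof.
case: s x y => x y /=; first exact: ler_normD.
by have := ler_normD x y; rewrite lecE /= => /andP[].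
Qed.

Lemma modulus1 : modulus (1 : K) = 1.
Proof.
case: s; first exact: normr1.
by rewrite /modulus [X in complex.Re X](@normr1 R[i]).
Qed.

Lemma modulusD_ge0 x y : 0 <= x -> 0 <= y ->
  modulus (x + y) = modulus x + modulus y.
Proof.
case: s x y => x y x0 y0; rewrite /modulus; first by rewrite !ger0_norm ?addr_ge0.
rewrite [X in complex.Re X](@ger0_norm R[i] _ (addr_ge0 x0 y0)).
by rewrite !(@ger0_norm R[i])//; case: x y {x0 y0} => [? ?] [? ?].
Qed.

Lemma modulusM x y : modulus (x * y) = modulus x * modulus y.
Proof.
case: s x y => x y; first exact: normrM.
rewrite /modulus [X in complex.Re X](@normrM R[i] x y).
by rewrite !normc_def /= mul0r subr0.
Qed.

Lemma modulus0 : modulus (0 : K) = 0.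
Proof.
case: s; first exact: normr0.
by rewrite /modulus [X in complex.Re X](@normr0 R[i] R[i]).
Qed.

Lemma modulusN x : modulus (- x) = modulus x.
Proof.
case: s x => x; first exact: normrN.
by rewrite /modulus [X in complex.Re X](@normrN R[i] R[i] x).
Qed.

Lemma nbhs_modulus (x : K^o) (e : R) : 0 < e ->
  nbhs x [set y : K^o | modulus (y - x : K) < e].
Proof.
case: s x => x e0 /=.
  apply/(@nbhs_ballP _ R^o); exists e => //= y.
  by rewrite -ball_normE /= distrC.
apply/(@nbhs_ballP _ R[i]^o); exists e%:C => /=; first by rewrite ltcR.
by move=> y; rewrite -ball_normE /= distrC ltcE /= => /andP[].
Qed.

End modulus_theory.

Record kothe_matrix (R : realType) := KotheMatrix {
  kothe_fun :> nat -> nat -> R ;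
  kothe_ge0 : forall j m, 0 <= kothe_fun j m ;
  kothe_le : forall j m, kothe_fun j m <= kothe_fun j m.+1 ;
  kothe_gt0 : forall j, exists m, 0 < kothe_fun j m }.

Section kothe_space.
Context (R : realType) (s : scalars) (A : kothe_matrix R).
Local Notation K := (scalar_field R s).

Definition kothe_norm (m : nat) (xi : nat -> K^o) : \bar R :=
  (\sum_(0 <= j <oo) (modulus (xi j : K) * A j m)%:E)%E.

Definition kothe_pred : {pred nat -> K^o} :=
  fun xi => `[< forall m, (kothe_norm m xi < +oo)%E >].

Let term_ge0 (xi : nat -> K^o) m j :
  (0 <= (modulus (xi j : K) * A j m)%:E)%E.
Proof. by rewrite lee_fin mulr_ge0 ?modulus_ge0 ?kothe_ge0. Qed.

Lemma kothe_norm_ge0 m xi : (0 <= kothe_norm m xi)%E.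
Proof. by apply: nneseries_ge0 => j _ _; exact: term_ge0. Qed.

Lemma kothe_norm0 m : kothe_norm m 0 = 0%E.
Proof.
by rewrite /kothe_norm eseries0// => j _ _; rewrite (modulus0 R s) mul0r.
Qed.

Lemma kothe_normD m xi eta :
  (kothe_norm m (xi + eta)%R <= kothe_norm m xi + kothe_norm m eta)%E.
Proof.
rewrite /kothe_norm -nneseriesD; [|by move=> *; exact: term_ge0..].
apply: lee_nneseries => [j _ _|j _]; first exact: (term_ge0 (xi + eta)).
by rewrite -EFinD lee_fin -mulrDl ler_wpM2r ?kothe_ge0// modulusD.
Qed.

Lemma kothe_normZ m (a : K) xi :
  kothe_norm m (a *: xi)%R = ((modulus a)%:E * kothe_norm m xi)%E.
Proof.
rewrite /kothe_norm -nneseriesZl; last by move=> *; exact: term_ge0.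
by apply: eq_eseriesr => j _; rewrite -EFinM mulrA -modulusM.
Qed.

Lemma kothe_normN m xi : kothe_norm m (- xi) = kothe_norm m xi.
Proof. by apply: eq_eseriesr => j _; rewrite (modulusN (xi j : K)). Qed.

Lemma le_kothe_norm m n xi : (m <= n)%N ->
  (kothe_norm m xi <= kothe_norm n xi)%E.
Proof.
move=> mn; apply: lee_nneseries => [j _ _|j _]; first exact: term_ge0.
rewrite lee_fin ler_wpM2l ?modulus_ge0//.
elim: n mn => [|n ih]; first by rewrite leqn0 => /eqP ->.
by rewrite leq_eqVlt ltnS => /predU1P[->//|/ih/le_trans]; apply; exact: kothe_le.
Qed.

Lemma kothe_submod_closed : submod_closed kothe_pred.
Proof.
split=> [|a xi eta /asboolP xiA /asboolP etaA]; apply/asboolP => m.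
  by rewrite kothe_norm0 ltry.
apply: le_lt_trans (kothe_normD _ _ _) _.
rewrite kothe_normZ lte_add_pinfty// lte_mul_pinfty ?lee_fin ?modulus_ge0//.
Qed.

HB.instance Definition _ :=
  GRing.isSubmodClosed.Build K (nat -> K^o) kothe_pred kothe_submod_closed.

Record kothe_space := KotheSpace {
  kothe_seq :> nat -> K^o ;
  kothe_seqP : kothe_seq \in kothe_pred }.

HB.instance Definition _ := [isSub for kothe_seq].
HB.instance Definition _ := [Choice of kothe_space by <:].
HB.instance Definition _ := [SubChoice_isSubLmodule of kothe_space by <:].

Definition kothe_ball m (x : kothe_space) (e : R) : set kothe_space :=
  [set y : kothe_space | (kothe_norm m (y - x)%R < e%:E)%E].

(* The seminorms increase with [m], so the balls of the single seminorms, without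
   finite intersections, already form a neighbourhood base. *)
Definition kothe_nbhs (x : kothe_space) : set_system kothe_space :=
  [set U | exists m, exists2 e : R, 0 < e & kothe_ball m x e `<=` U].

HB.instance Definition _ := hasNbhs.Build kothe_space kothe_nbhs.

Lemma kothe_norm_lty m (x : kothe_space) : (kothe_norm m x < +oo)%E.
Proof. by case: x => x /= /asboolP. Qed.

Lemma kothe_norm_fin m (x : kothe_space) : kothe_norm m x \is a fin_num.
Proof. by rewrite ge0_fin_numE ?kothe_norm_ge0 ?kothe_norm_lty. Qed.

Lemma nbhs_kothe_ball m x e : 0 < e -> nbhs x (kothe_ball m x e).
Proof. by move=> e0; exists m, e. Qed.

Let kothe_nbhs_filter (x : kothe_space) : ProperFilter (nbhs x).
Proof.
split; last split.
- move=> [m [e e0]] /(_ x); apply; rewrite /kothe_ball /=.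
  by rewrite subrr kothe_norm0 lte_fin.
- by exists 0%N, 1.
- move=> U V [m [e e0 eU]] [n [d d0 dV]]; exists (maxn m n), (Num.min e d).
    by rewrite lt_min e0.
  move=> y; rewrite /kothe_ball /= EFin_min lt_min => /andP[ye yd].
  split; [apply: eU|apply: dV].
    exact: le_lt_trans (le_kothe_norm _ (leq_maxl m n)) ye.
  exact: le_lt_trans (le_kothe_norm _ (leq_maxr m n)) yd.
- by move=> U V UV [m [e e0 eU]]; exists m, e => //; exact: subset_trans UV.
Qed.

Let kothe_nbhs_singleton (x : kothe_space) U : nbhs x U -> U x.
Proof.
by move=> [m [e e0 eU]]; apply: eU; rewrite /kothe_ball /= subrr kothe_norm0 lte_fin.
Qed.

Lemma kothe_ball_sub m (x y : kothe_space) e : kothe_ball m x e y ->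
  exists2 d, 0 < d & kothe_ball m y d `<=` kothe_ball m x e.
Proof.
rewrite /kothe_ball /=; set u := kothe_norm m _ => ue.
have ufin : u \is a fin_num by exact: (kothe_norm_fin m (y - x)).
exists (e - fine u) => [|z /= zd].
  by rewrite subr_gt0 -lte_fin fineK.
have -> : kothe_seq z - kothe_seq x =
    (kothe_seq z - kothe_seq y) + (kothe_seq y - kothe_seq x).
  by rewrite addrA subrK.
apply: le_lt_trans (kothe_normD _ _ _) _.
rewrite -/u -lteBrDr//; apply: lt_le_trans zd _.
by rewrite EFinB fineK.
Qed.

Let kothe_nbhs_nbhs (x : kothe_space) U : nbhs x U -> nbhs x (nbhs^~ U).
Proof.
move=> [m [e e0 eU]]; exists m, e => // y /kothe_ball_sub[d d0 dxe].
by exists m, d => //; exact: subset_trans eU.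
Qed.

HB.instance Definition _ := Nbhs_isNbhsTopological.Build kothe_space
  kothe_nbhs_filter kothe_nbhs_singleton kothe_nbhs_nbhs.

Let kothe_add_continuous :
  continuous (fun z : kothe_space * kothe_space => z.1 + z.2).
Proof.
move=> [x y] /= U [m [e e0 eU]].
have e20 : 0 < e / 2 by rewrite divr_gt0.
exists (kothe_ball m x (e / 2), kothe_ball m y (e / 2)).
  by split; exact: nbhs_kothe_ball.
move=> [x' y'] /= [xx' yy']; apply: eU; rewrite /kothe_ball /=.
have -> : kothe_seq x' + kothe_seq y' - (kothe_seq x + kothe_seq y) =
    (kothe_seq x' - kothe_seq x) + (kothe_seq y' - kothe_seq y).
  by rewrite opprD addrACA.
apply: le_lt_trans (kothe_normD _ _ _) _.
by rewrite (splitr e) EFinD lteD.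
Qed.

Let kothe_scale_continuous :
  continuous (fun z : K^o * kothe_space => z.1 *: z.2).
Proof.
move=> [a x] /= U [m [e e0 eU]].
pose C := fine (kothe_norm m x).
have C0 : 0 <= C by rewrite fine_ge0// kothe_norm_ge0.
have CE : kothe_norm m x = C%:E by rewrite fineK// kothe_norm_fin.
have a0 := modulus_ge0 (a : K).
pose d := Num.min 1 (e / (modulus (a : K) + 1 + C + 1)).
have D0 : 0 < modulus (a : K) + 1 + C + 1 by rewrite ltr_wpDl// !addr_ge0.
have d0 : 0 < d by rewrite lt_min ltr01 divr_gt0.
exists ([set b : K^o | modulus (b - a : K) < d], kothe_ball m x d).
  by split; [exact: nbhs_modulus|exact: nbhs_kothe_ball].
move=> [b y] /= [ab xy]; apply: eU; rewrite /kothe_ball /=.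
have -> : b *: kothe_seq y - a *: kothe_seq x =
    b *: (kothe_seq y - kothe_seq x) + (b - a : K) *: kothe_seq x.
  by rewrite scalerBr scalerBl addrA subrK.
apply: le_lt_trans (kothe_normD _ _ _) _.
rewrite !kothe_normZ CE.
have yfin : kothe_norm m (y - x)%R \is a fin_num.
  exact: (kothe_norm_fin m (y - x)).
move: xy; rewrite /kothe_ball /= -(fineK yfin) -!EFinM -EFinD !lte_fin => xy.
have y0 : 0 <= fine (kothe_norm m (y - x)%R) by rewrite fine_ge0// kothe_norm_ge0.
have ba : modulus (b : K) <= modulus (a : K) + 1.
  have -> : (b : K) = (a : K) + (b - a : K) by rewrite addrC subrK.
  apply: le_trans (modulusD _ _) _; rewrite lerD2l; apply: ltW.
  by apply: lt_le_trans ab _; rewrite ge_min lexx.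
have dD : d * (modulus (a : K) + 1 + C + 1) <= e.
  by rewrite -ler_pdivlMr// ge_min lexx orbT.
apply: lt_le_trans dD; rewrite !mulrDr mulr1.
apply: (@le_lt_trans _ _ (d * (modulus (a : K) + 1) + d * C)); last first.
  by rewrite !mulrDr mulr1 ltrDl.
rewrite lerD//; last by rewrite ler_wpM2r// ltW.
by rewrite mulrC ler_pM ?modulus_ge0// ltW.
Qed.

Let ereal_conv_lt (c d e : R) (u v : \bar R) : 0 <= c -> 0 <= d -> c + d = 1 ->
  (0 <= u)%E -> (0 <= v)%E -> (u < e%:E)%E -> (v < e%:E)%E ->
  (c%:E * u + d%:E * v < e%:E)%E.
Proof.
move=> c0 d0 cd; case: u => [p| |] //; case: v => [q| |] // _ _.
rewrite -!EFinM -EFinD !lte_fin => pe qe.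
apply: (@le_lt_trans _ _ (Num.max p q)); last by rewrite gt_max pe.
rewrite -[leRHS]mul1r -cd mulrDl lerD// ler_wpM2l//.
  by rewrite le_max lexx.
by rewrite le_max lexx orbT.
Qed.

Lemma kothe_ball_conv m x e (t : K) (y z : kothe_space) : 0 <= t -> t <= 1 ->
  kothe_ball m x e y -> kothe_ball m x e z ->
  kothe_ball m x e (t *: y + (1 - t) *: z).
Proof.
move=> t0 t1; rewrite /kothe_ball /=.
have -> : t *: kothe_seq y + (1 - t) *: kothe_seq z - kothe_seq x =
    t *: (kothe_seq y - kothe_seq x) + (1 - t) *: (kothe_seq z - kothe_seq x).
  by rewrite !scalerBr addrACA -opprD -scalerDl [t + _]addrC subrK scale1r.
move=> ye ze; apply: le_lt_trans (kothe_normD _ _ _) _; rewrite !kothe_normZ.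
apply: ereal_conv_lt; rewrite ?modulus_ge0 ?kothe_norm_ge0//.
by rewrite -modulusD_ge0 ?subr_ge0// addrC subrK modulus1.
Qed.

Let kothe_locally_convex : exists2 B : set_system kothe_space,
  (forall b, b \in B -> convex_set b) & basis B.
Proof.
exists [set b | exists m x e, b = kothe_ball m x e].
  move=> b /set_mem[m [x [e ->]]] y z t /set_mem yx /set_mem zx; apply/mem_set.
  by apply: kothe_ball_conv => //; exact: le1.
split=> [_ [m [x [e ->]]]|x U [m [e e0 eU]]].
  rewrite openE => y /kothe_ball_sub[d d0 dxe].
  by exists m, d.
exists (kothe_ball m x e) => //; split; first by exists m, x, e.
by rewrite /kothe_ball /= subrr kothe_norm0 lte_fin.
Qed.

HB.instance Definition _ := PreTopologicalLmod_isTvs.Build K kothe_space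
  kothe_add_continuous kothe_scale_continuous kothe_locally_convex.
(* The factory above only provides the uniform structure. *)
HB.instance Definition _ :=
  PreTopologicalNmodule_isTopologicalNmodule.Build kothe_space
    kothe_add_continuous.
HB.instance Definition _ :=
  TopologicalNmodule_isTopologicalLmodule.Build K kothe_space
    kothe_scale_continuous.
HB.instance Definition _ :=
  Uniform_isTvs.Build K kothe_space kothe_locally_convex.

Definition lambda : tvsType K := kothe_space.

End kothe_space.

Section locally_convex_spaces.
Context (R : realType) (s : scalars).
Local Notation K := (scalar_field R s).
Implicit Types E F : tvsType K.

Definition metrizable E := exists d : E -> E -> R,
  [/\ forall x y, 0 <= d x y,
      forall x y, d x y = 0 <-> x = y,
      forall x y, d x y = d y x,
      forall x y z, d x z <= d x y + d y z &
      forall (x : E) (U : set E), nbhs x U <->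
        exists2 e, 0 < e & [set y | d x y < e] `<=` U].

(* [tvsType] does not require its entourages to be translation invariant, so
   completeness is expressed with the uniformity of the additive group. *)
Definition tvs_cauchy E (F : set_system E) := forall U : set E, nbhs 0 U ->
  exists2 B, F B & forall x y, B x -> B y -> U (x - y).

Definition tvs_complete E := forall F : set_system E,
  ProperFilter F -> tvs_cauchy F -> exists x : E, F --> x.

Definition frechet E := metrizable E /\ tvs_complete E.

Definition tvs_bounded E (B : set E) := forall U : set E, nbhs 0 U ->
  exists2 a : K, 0 < a & B `<=` [set a *: u | u in U].

Definition balanced E (B : set E) :=
  forall (a : K) (x : E), `|a| <= 1 -> B x -> B (a *: x).

Definition absorbing E (B : set E) :=
  forall x : E, exists2 r : K, 0 < r & forall a : K, `|a| <= r -> B (a *: x).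

Definition barrelled E := forall B : set E,
  closed B -> convex_set B -> balanced B -> absorbing B -> nbhs 0 B.

Definition montel E := [/\ hausdorff_space E, barrelled E &
  forall B : set E, tvs_bounded B -> compact (closure B)].

Definition seminorm E (p : E -> R) :=
  [/\ forall x, 0 <= p x,
      forall x y, p (x + y) <= p x + p y &
      forall (a : K) x, p (a *: x) = modulus a * p x].

Definition admits_continuous_norm E := exists p : E -> R,
  [/\ seminorm p, forall x, p x = 0 -> x = 0 & continuous p].

(* The canonical map from E / ker q (normed by [q]) to E / ker p (normed by [p])
   is nuclear: it is the sum of a series of rank-one maps [f i] (x) [y i], with
   [c i] a bound for the dual norm of [f i] and \sum_i c i * p (y i) finite.
   Taking the [y i] in the completion of E / ker p instead gives the same notion,
   since E / ker p is dense there. *)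
Definition nuclear_link E (q p : E -> R) :=
  exists (f : nat -> {linear E -> K^o}) (y : nat -> E) (c : nat -> R),
    [/\ forall i, 0 <= c i,
        forall i x, modulus (f i x : K) <= c i * q x,
        cvgn (series (fun i => c i * p (y i))) &
        forall x, p (x - \sum_(i < n) f i x *: y i) @[n --> \oo] --> (0 : R)].

Definition nuclear E := forall p : E -> R, seminorm p -> continuous p ->
  exists q : E -> R, [/\ seminorm q, continuous q,
    forall x, p x <= q x & nuclear_link q p].

Definition subspace_isomorphic E (G : set E) F :=
  exists (T : {linear F -> E}) (S : E -> F),
    [/\ continuous T, {within G, continuous S}, cancel T S & range T = G].

End locally_convex_spaces.

Section decompositions.
Context (R : realType) (s : scalars).
Local Notation K := (scalar_field R s).
Context (E : tvsType K).
Implicit Types (A : nat -> {linear E -> E}) (G : set E) (M : set nat).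

Definition lin_span G : set E :=
  [set x | exists n (c : 'I_n -> K) (v : 'I_n -> E),
    (forall i, G (v i)) /\ x = \sum_i c i *: v i].

Definition closed_span G : set E := closure (lin_span G).

Definition linear_subspace G :=
  G 0 /\ forall (a : K) x y, G x -> G y -> G (a *: x + y).

Definition dim_le (k : nat) G := exists b : 'I_k -> E,
  G = [set x | exists c : 'I_k -> K, x = \sum_i c i *: b i].

Definition block A n : set E := range (A n).

Definition fdd A :=
  [/\ forall n, continuous (A n) /\ exists k, dim_le k (block A n),
      forall m n x, A n (A m x) = if m == n then A n x else 0,
      forall x, series (fun n => A n x) @ \oo --> x &
      forall n, block A n != [set 0]].

Definition k_fdd (k : nat) A := fdd A /\ forall n, dim_le k (block A n).

Definition unconditionally_cvg (u : nat -> E) := forall sigma : nat -> nat,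
  bijective sigma -> exists l : E, series (u \o sigma) @ \oo --> l.

Definition unconditional A :=
  forall x, unconditionally_cvg (fun n => A n x).

Definition block_sum A M : set E := closed_span (\bigcup_(n in M) block A n).

Definition step_subspace A G :=
  linear_subspace G /\ G = closed_span (\bigcup_n (G `&` block A n)).

Definition naturally_complemented A G :=
  step_subspace A G /\
  exists P : {linear E -> E},
    [/\ continuous P, forall x, P (P x) = P x, range P = G &
        forall n x, P (A n x) = A n (P x)].

Definition naturally_complemented_subseq A (x : nat -> E) M :=
  infinite_set M /\ naturally_complemented A (closed_span (x @` M)).

End decompositions.

(* Main.v *)
From HB Require Import structures.
Require Import Defs.
From mathcomp Require Import all_boot all_order all_algebra.
From mathcomp Require Import complex.
From mathcomp Require Import all_classical all_reals all_analysis.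
From mathcomp Require Import lra.
Set Implicit Arguments.
Unset Strict Implicit.
Unset Printing Implicit Defensive.

Import Order.TTheory GRing.Theory Num.Theory.
Import numFieldNormedType.Exports.
Local Open Scope classical_set_scope.
Local Open Scope ring_scope.

(** The topology of [E] is given by an increasing sequence of norms [p m]
    ([fundamental_exists]). Both claims follow from the existence, inside
    infinitely many blocks, of vectors [e j] with biorthogonal functionals [f j]
    (each factoring through a single [A n]) such that for every [m] there are [l]
    and [D] with
      [p m (e j) * modulus (f j y) <= D * 2^-1 ^+ j * p l y] for all [j] and [y].
    Under this estimate [y |-> \sum_j f j y *: e j] converges absolutely and is a
    continuous projection onto the closed span of the [e j], and the coordinates
    [f j y] identify that span with the Koethe space of the weights [p m (e j)].
    Testing the estimate at [y = e j] shows that quotients of these weights are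
    summable, so this Koethe space is nuclear ([system_projection],
    [system_isomorphic], [system_nuclear]). The projection commutes with every
    [A n] because each [f j] factors through a single block.

    Two ideas produce such systems.

    The first is [tame_functional]: for vectors [x n] in blocks of bounded
    dimension there are functionals [f n] on the blocks with [f n (x n) = 1] such
    that, for every [m], the product [p m (x n) * modulus (f n y)] is at most
    [C * p l y], with [l] and [C] independent of [n]. For a single [m] this would
    be the Hahn-Banach theorem; what is needed is one functional that works for all
    [m], and [l] must not depend on [n]. Asymptotic comparisons are made along a
    nonprincipal ultrafilter, so that each of them is decided without
    passing to subsequences. A block is exhausted by adding one spanning vector at a
    time. At each level [m] the possible values of the
    functional on the new vector form a ball in the scalar field, and the balls of
    different levels are reconciled by a dichotomy ([near_center]): either one
    centre is close enough to all the others, or every centre is close to all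
    sufficiently late ones, and then a centre whose index tends slowly to infinity
    does. Bounded dimension makes the number of these extension steps independent
    of [n]. Repeating the construction in the kernels yields bases of the blocks
    with tame coordinates ([adapted_basis_exists]).

    The second is [montel_decay]: in a Montel space, [p m (e n)] is negligible
    with respect to [p m' (e n)] for some [m'], since otherwise the normalized
    vectors would be a bounded sequence without cluster point. Passing to a sparse
    set of blocks turns this into the factors [2^-1 ^+ j]
    ([nuclear_subsystem]). *)

(** * Scalars *)

Lemma modulus_complex (R : realType) (z : scalar_field R ComplexScalars) :
  modulus z = Num.sqrt (complex.Re z ^+ 2 + complex.Im z ^+ 2).
Proof. by rewrite /modulus normc_def. Qed.

Section scalars.
Context {R : realType} {s : scalars}.
Local Notation K := (scalar_field R s).
Implicit Types a b : K.

Lemma modulus_norm a : modulus (`|a| : K) = modulus a.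
Proof.
case: s a => a; first exact: normr_id.
by rewrite /modulus; congr complex.Re; exact: (@normr_id R[i] R[i]).
Qed.

Lemma le_modulus a b : (`|a| <= `|b|) = (modulus a <= modulus b).
Proof.
by case: s a b => a b //; rewrite /modulus (@normc_def R a) (@normc_def R b) lecR.
Qed.

Lemma modulus_le1 a : (`|a| <= 1) = (modulus a <= 1).
Proof. by rewrite -(normr1 K) le_modulus modulus1. Qed.

Lemma modulus_eq0 a : modulus a = 0 -> a = 0.
Proof.
move=> a0; apply/eqP; rewrite -normr_le0 -(normr0 K) le_modulus.
by rewrite a0 modulus_ge0.
Qed.

Lemma modulus_gt0 a : a != 0 -> 0 < modulus a.
Proof.
by move=> a0; rewrite lt_neqAle modulus_ge0 eq_sym andbT; apply: contra_neq a0 => /modulus_eq0.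
Qed.

Lemma modulusV a : modulus a^-1 = (modulus a)^-1.
Proof.
have [->|a0] := eqVneq a 0; first by rewrite invr0 modulus0 invr0.
have ma0 : modulus a != 0 by rewrite lt0r_neq0// modulus_gt0.
by apply: (mulfI ma0); rewrite -modulusM !mulfV// modulus1.
Qed.

Lemma modulus_dist a b : modulus (a - b) = modulus (b - a).
Proof. by rewrite -opprB modulusN. Qed.

Lemma modulusB a b c : modulus (a - c) <= modulus (a - b) + modulus (b - c).
Proof. by apply: le_trans _ (modulusD _ _); rewrite addrA subrK. Qed.

(** Over either field, every nonnegative real is a modulus; this is how real
    radii are turned into scalars. *)
Lemma modulus_surj (r : R) : 0 < r -> exists2 a : K, 0 < a & modulus a = r.
Proof.
move=> r0; case: s; first by exists r => //; exact: gtr0_norm.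
exists r%:C%C; first by rewrite /= ltcR.
by rewrite modulus_complex /= expr0n addr0 sqrtr_sqr gtr0_norm.
Qed.

Lemma real_complete (u : nat -> R) :
  (forall e : R, 0 < e -> exists N, forall i j, (N <= i)%N -> (N <= j)%N ->
    `|u i - u j| < e) ->
  exists l, forall e : R, 0 < e -> exists N, forall i, (N <= i)%N -> `|u i - l| < e.
Proof.
move=> cu.
have /cauchy_cvg uc : cauchy (u @ \oo).
  apply/cauchy_ballP => e e0.
  have [N uN] := cu _ e0; exists (u @` [set i | (N <= i)%N], u @` [set i | (N <= i)%N]).
    by split; exists N => // i Ni; exists i.
  by move=> [_ _] /= [[i Ni <-] [j Nj <-]]; exact: uN.
exists (lim (u @ \oo)) => e e0.
have /cvgrPdist_lt/(_ _ e0)[N _ uN] := uc.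
by exists N => i Ni; rewrite distrC; exact: uN.
Qed.

(** Stated with [modulus], so that both scalar fields are covered; the complex
    case is reduced to the real and imaginary parts. *)
Lemma scalar_complete (u : nat -> K) :
  (forall e : R, 0 < e -> exists N, forall i j, (N <= i)%N -> (N <= j)%N ->
    modulus (u i - u j) < e) ->
  exists l, forall e : R, 0 < e -> exists N, forall i, (N <= i)%N ->
    modulus (u i - l) < e.
Proof.
case: s u => u cu; first exact: real_complete.
pose X (z : scalar_field R ComplexScalars) := complex.Re z.
pose Y (z : scalar_field R ComplexScalars) := complex.Im z.
have mE z : modulus z = Num.sqrt (X z ^+ 2 + Y z ^+ 2).
  exact: modulus_complex.
have absX z : `|X z| <= modulus z.
  by rewrite mE -sqrtr_sqr ler_wsqrtr// lerDl sqr_ge0.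
have absY z : `|Y z| <= modulus z.
  by rewrite mE -sqrtr_sqr ler_wsqrtr// lerDr sqr_ge0.
have absD z : modulus z <= `|X z| + `|Y z|.
  rewrite mE -[leRHS]ger0_norm ?addr_ge0// -[leRHS]sqrtr_sqr.
  rewrite ler_wsqrtr// sqrrD !real_normK ?num_real//.
  by rewrite lerD2r lerDl mulrn_wge0// mulr_ge0.
have XB y z : X (y - z) = X y - X z by case: y z => [? ?] [? ?].
have YB y z : Y (y - z) = Y y - Y z by case: y z => [? ?] [? ?].
have [a ua] : exists l, forall e : R, 0 < e -> exists N, forall i, (N <= i)%N ->
    `|X (u i) - l| < e.
  apply: real_complete => e /cu[N uN]; exists N => i j Ni Nj.
  by apply: le_lt_trans (uN i j Ni Nj); rewrite -XB.
have [b ub] : exists l, forall e : R, 0 < e -> exists N, forall i, (N <= i)%N ->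
    `|Y (u i) - l| < e.
  apply: real_complete => e /cu[N uN]; exists N => i j Ni Nj.
  by apply: le_lt_trans (uN i j Ni Nj); rewrite -YB.
exists (Complex a b) => e e0; have e2 : 0 < e / 2 by rewrite divr_gt0.
have [N uN] := ua _ e2; have [M uM] := ub _ e2; exists (maxn N M) => i.
rewrite geq_max => /andP[Ni Mi]; apply: le_lt_trans (absD _) _.
by rewrite (splitr e) XB YB; apply: ltrD; [exact: uN|exact: uM].
Qed.

End scalars.

(** * Ultrafilter asymptotics *)

Section ultrafilter.
Context {R : realType} {s : scalars}.
Local Notation K := (scalar_field R s).
Context (U : set_system nat) {UU : UltraFilter U}.
Hypothesis Uinf : forall N, \forall n \near U, (N <= n)%N.

Lemma not_near (P : nat -> Prop) :
  ~ (\forall n \near U, P n) -> \forall n \near U, ~ P n.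
Proof. by move=> nP; have [|] := in_ultra_setVsetC [set n | P n] UU. Qed.

Lemma near_leq (Q : nat -> nat -> Prop) : (forall i, \forall n \near U, Q i n) ->
  forall N, \forall n \near U, forall i, (i <= N)%N -> Q i n.
Proof.
move=> Qn; elim=> [|N IH].
  by apply: filterS (Qn 0%N) => n Q0 i; rewrite leqn0 => /eqP ->.
apply: filterS2 IH (Qn N.+1) => n QN QN1 i.
by rewrite leq_eqVlt => /predU1P[->//|]; rewrite ltnS; exact: QN.
Qed.

(** Countably many eventual properties hold simultaneously along an index [nu n]
    that tends to infinity slowly enough: take the largest [N <= n] with [P N n]. *)
Lemma near_slow_index (P : nat -> nat -> Prop) :
  (forall N, \forall n \near U, P N n) ->
  exists nu : nat -> nat, (\forall n \near U, P (nu n) n) /\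
    forall N, \forall n \near U, (N <= nu n)%N.
Proof.
move=> PU.
have /choice[nu nuP] : forall n, exists k, forall N, (N <= n)%N -> P N n ->
    (N <= k)%N /\ P k n.
  move=> n; have [[N0 [Nn0 P0]]|noN] := pselect (exists N, (N <= n)%N /\ P N n).
    pose Q N := (N <= n)%N && `[< P N n >].
    have Qex : exists N, Q N by exists N0; rewrite /Q Nn0; apply/asboolP.
    have Qub N : Q N -> (N <= n)%N by case/andP.
    have [k /andP[_ /asboolP Pk] kmax] := ex_maxnP Qex Qub.
    by exists k => N Nn PN; split=> //; apply: kmax; rewrite /Q Nn; apply/asboolP.
  by exists 0%N => N Nn PN; case: noN; exists N.
exists nu; split=> [|N].
  by apply: filterS (PU 0%N) => n /(nuP _ _ (leq0n n))[].
by apply: filterS2 (Uinf N) (PU N) => n Nn /(nuP _ _ Nn)[].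
Qed.

Lemma near_subsequence (Q : nat -> nat -> Prop) :
  (forall r, \forall n \near U, Q r n) ->
  exists nu : nat -> nat, {homo nu : i j / (i < j)%N} /\ forall r, Q r (nu r).
Proof.
move=> QU.
have /choice[g gP] : forall rk : nat * nat, exists n, (rk.2 < n)%N /\ Q rk.1 n.
  move=> [r k]; have [n [kn Qn]] := filter_ex (filterI (Uinf k.+1) (QU r)).
  by exists n.
pose nu := fix nu r := if r is r'.+1 then g (r, nu r') else g (0, 0)%N.
exists nu; split; last by case=> [|r]; [exact: (gP (0, 0)%N).2|exact: (gP (_, _)).2].
by apply: homo_ltn => [i j k|i]; [exact: ltn_trans|exact: (gP (_, _)).1].
Qed.

(** Each level [m] has a centre [z m n] and tolerates an error [rho l n / alpha m n]
    up to constants, for a freely chosen [l] that does not depend on [n]. If some centre [z i]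
    meets all these tolerances, it is the answer. Otherwise every [z i n] is much
    farther from some later [z m n] than [z m n] is from all the centres that
    follow it; then the later centres are all about as close to [z i n] as [z m n]
    is, and a slowly increasing choice of centre works. *)
Lemma near_center (alpha rho : nat -> nat -> R) (z : nat -> nat -> K) :
  (forall m n, 0 <= alpha m n) ->
  (forall m j, (m <= j)%N -> exists C, \forall n \near U,
    alpha m n * modulus (z m n - z j n) <= C * rho j n) ->
  exists t : nat -> K, forall m, exists l C, \forall n \near U,
    alpha m n * modulus (t n - z m n) <= C * rho l n.
Proof.
move=> alpha0 zz.
have [[i zi]|nozi] := pselect (exists i, forall m, (i < m)%N ->
    exists l C, \forall n \near U, alpha m n * modulus (z i n - z m n) <= C * rho l n).
  exists (z i) => m; have [im|mi] := ltnP i m; first exact: zi.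
  have [C zC] := zz _ _ mi; exists i, C.
  by apply: filterS zC => n; rewrite modulus_dist.
have /choice[mm mmP] : forall i, exists m, (i < m)%N /\ forall l C,
    \forall n \near U, C * rho l n < alpha m n * modulus (z i n - z m n).
  move=> i; apply: contrapT => noi; apply: nozi; exists i => m im.
  apply: contrapT => nol; apply: noi; exists m; split=> // l C.
  have /not_near : ~ \forall n \near U, alpha m n * modulus (z i n - z m n) <= C * rho l n.
    by move=> zl; apply: nol; exists l, C.
  by apply: filterS => n /negP; rewrite -ltNge.
have /choice[C CP] i : exists C, \forall n \near U,
    alpha i n * modulus (z i n - z (mm i) n) <= C * rho (mm i) n.
  exact/zz/ltnW/(mmP i).1.
pose P N n := forall i, (i <= N)%N -> (mm i <= N)%N ->
  alpha i n * modulus (z N n - z i n) <= (2 * C i) * rho (mm i) n.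
have PU N : \forall n \near U, P N n.
  apply: near_leq => i; have [miN|Nmi] := leqP (mm i) N; last exact: filterE.
  have [D zD] := zz _ _ miN.
  apply: filterS3 zD (CP i) ((mmP i).2 N D) => n zD Ci zlt _.
  have : modulus (z (mm i) n - z N n) <= modulus (z i n - z (mm i) n).
    have /(le_lt_trans zD) := zlt.
    have := alpha0 (mm i) n; rewrite le_eqVlt => /predU1P[<-|am].
      by rewrite !mul0r ltxx.
    by rewrite ltr_pM2l// => /ltW.
  move=> zle; rewrite -mulrA; apply: le_trans (ler_wpM2l _ Ci); last by [].
  rewrite mulrCA ler_wpM2l// modulus_dist mulr_natl mulr2n.
  by apply: le_trans (modulusB _ (z (mm i) n) _) _; rewrite lerD2l.
have [nu [Pnu nuinf]] := near_slow_index PU.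
exists (fun n => z (nu n) n) => m; exists (mm m), (2 * C m).
apply: filterS3 Pnu (nuinf m) (nuinf (mm m)) => n Pn mn mmn.
exact: Pn.
Qed.

End ultrafilter.

(** * Fundamental systems of norms *)

Section convex_balanced.
Context {R : realType} {s : scalars}.
Local Notation K := (scalar_field R s).
Context {E : tvsType K}.
Implicit Types (x y : E) (B V : set E) (p q : E -> R).

Lemma convex_setP B : convex_set B <->
  forall (t : K) x y, 0 <= t -> t <= 1 -> B x -> B y -> B (t *: x + (1 - t) *: y).
Proof.
split=> [cB t x y t0 t1 Bx By|cB x y t /set_mem Bx /set_mem By].
  by have /set_mem := cB x y (Itv01 t0 t1) (mem_set Bx) (mem_set By).
by apply/mem_set/cB => //; exact: le1.
Qed.

(** It suffices to bound a scaled argument: the opposite bound comes from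
    scaling back. *)
Lemma seminorm_intro p : (forall x, 0 <= p x) ->
  (forall x y, p (x + y) <= p x + p y) ->
  (forall (a : K) x, p (a *: x) <= modulus a * p x) -> seminorm p.
Proof.
move=> p0 pD pZ; split=> // a x; apply/eqP; rewrite eq_le pZ /=.
have [->|a0] := eqVneq a 0; first by rewrite modulus0 mul0r.
rewrite -ler_pdivlMl ?modulus_gt0//.
by have := pZ a^-1 (a *: x); rewrite modulusV scalerA mulVf// scale1r.
Qed.

Lemma seminormD p q : seminorm p -> seminorm q -> seminorm (fun x => p x + q x).
Proof.
move=> [p0 pD pZ] [q0 qD qZ]; split=> [x|x y|a x].
- by rewrite addr_ge0.
- by rewrite addrACA lerD.
- by rewrite pZ qZ mulrDr.
Qed.

(** The gauge of a balanced convex neighbourhood of zero. The infimum runs over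
    moduli of positive scalars because balls are scaled by scalars of [K]. *)
Section gauge.
Context (B : set E).
Hypotheses (Bconv : convex_set B) (Bbal : balanced B) (B0 : nbhs 0 B).

Let radii x : set R :=
  [set r | exists2 a : K, 0 < a & modulus a = r /\ B (a^-1 *: x)].
Let gauge x := inf (radii x).

Let balancedP (a b : K) x : modulus a <= modulus b -> B (b *: x) -> B (a *: x).
Proof.
have [->|b0] := eqVneq b 0.
  rewrite modulus0 => ma; have /modulus_eq0 -> // : modulus a = 0.
  by apply/eqP; rewrite eq_le ma modulus_ge0.
move=> ab Bx; have -> : a *: x = (a / b) *: (b *: x) by rewrite scalerA divfK.
apply: Bbal Bx; rewrite modulus_le1 modulusM modulusV.
by rewrite ler_pdivrMr ?modulus_gt0// mul1r.
Qed.

Let radii_lb x : lbound (radii x) 0.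
Proof. by move=> _ [a _ [<- _]]; exact: modulus_ge0. Qed.

Let radii_inf x : has_inf (radii x).
Proof.
split; last by exists 0; exact: radii_lb.
have : nbhs (0 : K^o) [set a : K^o | B (a *: x)].
  have := @scale_continuous _ E (0, x); rewrite /continuous_at /= scale0r.
  move=> /(_ _ B0)[[P Q] /= [P0 Qx] PQ].
  by apply: filterS P0 => a Pa; apply: (PQ (a, x)); split => //; exact: nbhs_singleton.
move=> /(@nbhs_ballP _ K^o)[e /= e0 eB].
have e2 : 0 < e / 2 by rewrite divr_gt0.
exists (modulus (e / 2)^-1), (e / 2)^-1; first by rewrite invr_gt0.
split=> //; rewrite invrK; apply: eB; rewrite -ball_normE /= sub0r normrN gtr0_norm//.
by rewrite ltr_pdivrMr// ltr_pMr// ltr1n.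
Qed.

Let gauge_le x (a : K) : 0 < a -> B (a^-1 *: x) -> gauge x <= modulus a.
Proof.
by move=> a0 Ba; apply: ge_inf; [exists 0; exact: radii_lb|exists a].
Qed.

Let gauge_lt x r : gauge x < r ->
  exists2 a : K, 0 < a & modulus a < r /\ B (a^-1 *: x).
Proof.
rewrite -subr_gt0 => /inf_adherent/(_ (radii_inf x))[_ [a a0 [<- Ba]]].
by rewrite -/(gauge x) subrKC => ar; exists a.
Qed.

Let gauge_lt1 x : gauge x < 1 -> B x.
Proof.
move=> /gauge_lt[a a0 [a1 Ba]]; rewrite -[x]scale1r; apply: balancedP Ba.
by rewrite modulus1 modulusV invf_ge1 ?modulus_gt0 ?gt_eqF// ltW.
Qed.

Let gauge_seminorm : seminorm gauge.
Proof.
have g0 x : 0 <= gauge x by apply: lb_le_inf; [exact: (radii_inf x).1|exact: radii_lb].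
apply: seminorm_intro => // [x y|c x].
- apply/ler_addgt0Pl => e e0; have e2 : 0 < e / 2 by rewrite divr_gt0.
  have /gauge_lt[a a0 [ax Ba]] : gauge x < gauge x + e / 2 by rewrite ltrDl.
  have /gauge_lt[b b0 [bx Bb]] : gauge y < gauge y + e / 2 by rewrite ltrDl.
  have ab0 : 0 < a + b by rewrite addr_gt0.
  apply: (@le_trans _ _ (modulus (a + b))).
    apply: gauge_le => //.
    have -> : (a + b)^-1 *: (x + y) = (a / (a + b)) *: (a^-1 *: x) +
        (1 - a / (a + b)) *: (b^-1 *: y).
      have -> : 1 - a / (a + b) = b / (a + b).
        by rewrite -[X in X - _](@divff _ (a + b)) ?gt_eqF// -mulrBl addrAC subrr add0r.
      have cancel c : 0 < c -> c / (a + b) * c^-1 = (a + b)^-1.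
        by move=> c0; rewrite mulrAC divff ?mul1r ?gt_eqF.
      by rewrite !scalerA !cancel// scalerDr.
    move/convex_setP : Bconv; apply => //; first by rewrite divr_ge0// ltW.
    by rewrite ler_pdivrMr// mul1r lerDl ltW.
  by apply: le_trans (modulusD _ _) _; lra.
- have [->|c0] := eqVneq c 0.
    rewrite scale0r modulus0 mul0r; apply/ler_addgt0Pl => e e0; rewrite addr0.
    have [a a0 <-] := modulus_surj (s := s) e0.
    by apply: gauge_le => //; rewrite scaler0; exact: nbhs_singleton.
  rewrite -ler_pdivrMl ?modulus_gt0//.
  apply: lb_le_inf; first exact: (radii_inf x).1.
  move=> _ [a a0 [<- Ba]]; rewrite ler_pdivrMl ?modulus_gt0//.
  rewrite -(modulus_norm c) -modulusM; apply: gauge_le.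
    by rewrite mulr_gt0// normr_gt0.
  have -> : (`|c| * a)^-1 *: (c *: x) = (c / `|c|) *: (a^-1 *: x).
    by rewrite !scalerA invfM; congr (_ *: _); rewrite mulrC mulrA.
  apply: Bbal Ba; rewrite modulus_le1 modulusM modulusV modulus_norm.
  by rewrite divff// gt_eqF ?modulus_gt0.
Qed.

Lemma gauge_exists : exists p : E -> R, [/\ seminorm p,
  forall e, 0 < e -> nbhs 0 [set x | p x < e] & [set x | p x < 1] `<=` B].
Proof.
exists gauge; split; [exact: gauge_seminorm| |by move=> x; exact: gauge_lt1].
move=> e e0; have e2 : 0 < e / 2 by rewrite divr_gt0.
have [a a0 ae] := modulus_surj (s := s) e2.
have ane : a != 0 by rewrite gt_eqF.
apply: filterS (nbhs0Z ane B0) => _ [x Bx <-] /=.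
apply: (@le_lt_trans _ _ (modulus a)).
  by apply: gauge_le => //; rewrite scalerA mulVf// scale1r.
by rewrite ae ltr_pdivrMr// ltr_pMr// ltr1n.
Qed.

End gauge.

(** The balanced core of a convex neighbourhood is convex, balanced, and still a
    neighbourhood because scaling is continuous at [(0, 0)]. *)
Lemma seminorm_below V : nbhs 0 V -> exists p : E -> R, [/\ seminorm p,
  forall e, 0 < e -> nbhs 0 [set x | p x < e] & [set x | p x < 1] `<=` V].
Proof.
have [B Bconv [Bopen Bbasis]] := @locally_convex K E.
move=> V0; have [b [Bb b0] bV] := Bbasis 0 V V0.
have bconv := Bconv _ (mem_set Bb).
have bnbhs : nbhs 0 b by exact: open_nbhs_nbhs (conj (Bopen _ Bb) b0).
pose C : set E := [set x | forall a : K, `|a| <= 1 -> b (a *: x)].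
have [|||p [ps pn pC]] := @gauge_exists C.
- apply/convex_setP => t x y t0 t1 Cx Cy a a1; rewrite scalerDr !scalerA.
  rewrite ![a * _]mulrC -!scalerA; move/convex_setP : bconv; apply => //.
    exact: Cx.
  exact: Cy.
- move=> a x a1 Cx c c1; rewrite scalerA; apply: Cx.
  by rewrite normrM mulr_ile1.
- have := @scale_continuous _ E (0, 0); rewrite /continuous_at /= scale0r.
  move=> /(_ _ bnbhs)[[P Q] /= [/(@nbhs_ballP _ K^o)[e /= e0 eP] Q0] PQ].
  have e2 : 0 < e / 2 by rewrite divr_gt0.
  have e2n : e / 2 != 0 by rewrite gt_eqF.
  apply: filterS (nbhs0Z e2n Q0) => _ [x Qx <-] a a1; rewrite scalerA.
  apply: (PQ (_, x)); split=> //; apply: eP; rewrite -ball_normE /= sub0r normrN.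
  rewrite normrM (gtr0_norm e2); apply: (@le_lt_trans _ _ (e / 2)).
    by rewrite ler_piMl// ltW.
  by rewrite ltr_pdivrMr// ltr_pMr// ltr1n.
exists p; split=> // x /pC Cx; apply: bV.
by rewrite -[x]scale1r; apply: Cx; rewrite normr1.
Qed.

(** Increasing seminorms whose balls are a base at zero; [p 0], hence every [p m],
    is a norm, which is where the continuous norm of the space enters. *)
Record fundamental (p : nat -> E -> R) : Prop := Fundamental {
  fund_seminorm : forall m, seminorm (p m) ;
  fund_leS : forall m x, p m x <= p m.+1 x ;
  fund_norm : forall x, p 0%N x = 0 -> x = 0 ;
  fund_ball : forall m e, 0 < e -> nbhs 0 [set x | p m x < e] ;
  fund_nbhs : forall V, nbhs 0 V ->
    exists m, exists2 e, 0 < e & [set x | p m x < e] `<=` V }.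

(** Add up the continuous norm and gauges inside the balls of radius [1 / i.+1] of
    a metric. *)
Lemma fundamental_exists : frechet E -> admits_continuous_norm E ->
  exists p : nat -> E -> R, fundamental p.
Proof.
move=> [[d [d0 dE dC dD dn]] _] [q [qs qn qc]].
have /choice[g gP] i : exists p : E -> R, [/\ seminorm p,
    forall e, 0 < e -> nbhs 0 [set x | p x < e] &
    [set x | p x < 1] `<=` [set y | d 0 y < i.+1%:R^-1]].
  by apply: seminorm_below; apply/dn; exists i.+1%:R^-1 => //; rewrite invr_gt0.
pose p := fix p m : E -> R := if m is m'.+1 then fun x => p m' x + g m' x else q.
have ps m : seminorm (p m).
  by elim: m => [|m IH] //=; apply: seminormD => //; have [] := gP m.
have q0 : q 0 = 0 by case: qs => _ _ /(_ 0 0); rewrite scale0r modulus0 mul0r.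
exists p; split=> // [m x|m e e0|V /dn[e e0 eV]].
- by rewrite /= lerDl; have [[]] := gP m.
- elim: m e e0 => [|m IH] e e0 /=.
    have /cvgrPdist_lt/(_ _ e0) := qc 0; rewrite q0; apply: filterS => x /=.
    by rewrite sub0r normrN ger0_norm//; case: qs.
  have e2 : 0 < e / 2 by rewrite divr_gt0.
  have [_ /(_ _ e2) gn _] := gP m.
  apply: filterS2 (IH _ e2) gn => x /= px gx.
  by rewrite (splitr e) ltrD.
- have [i ie] : exists i, i.+1%:R^-1 < e.
    have [i _ /(_ _ (leqnn i))] := near_infty_natSinv_lt (PosNum e0).
    by exists i.
  exists i.+1, 1 => // x /= px; apply: eV => /=.
  have [_ _ gi] := gP i; apply: lt_trans ie; apply: gi => /=.
  by apply: le_lt_trans px; rewrite lerDr; case: (ps i).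
Qed.

End convex_balanced.

Section seminorm_theory.
Context {R : realType} {s : scalars}.
Local Notation K := (scalar_field R s).
Context {E : tvsType K} {p : E -> R}.
Hypothesis sp : seminorm p.

Lemma semi_ge0 x : 0 <= p x. Proof. by case: sp. Qed.
Lemma semiD x y : p (x + y) <= p x + p y. Proof. by case: sp. Qed.
Lemma semiZ (a : K) x : p (a *: x) = modulus a * p x. Proof. by case: sp. Qed.
Lemma semi0 : p 0 = 0.
Proof. by rewrite -(scale0r (0 : E)) semiZ modulus0 mul0r. Qed.
Lemma semiN x : p (- x) = p x.
Proof. by rewrite -scaleN1r semiZ modulusN modulus1 mul1r. Qed.
Lemma semi_distC x y : p (x - y) = p (y - x). Proof. by rewrite -opprB semiN. Qed.
Lemma semiB y x z : p (x - z) <= p (x - y) + p (y - z).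
Proof. by apply: le_trans (semiD _ _); rewrite addrA subrK. Qed.
Lemma semiB_le x y : p (x - y) <= p x + p y.
Proof. by apply: le_trans (semiD _ _) _; rewrite semiN. Qed.
Lemma semi_sum I (r : seq I) (P : pred I) (F : I -> E) :
  p (\sum_(i <- r | P i) F i) <= \sum_(i <- r | P i) p (F i).
Proof.
elim/big_ind2 : _ => [|x a y b xa yb|//]; first by rewrite semi0.
by apply: le_trans (semiD _ _) (lerD xa yb).
Qed.

End seminorm_theory.

Lemma nbhs_shift {K : numDomainType} {E : tvsType K} (x : E) (V : set E) :
  nbhs x V <-> nbhs 0 [set y | V (y + x)].
Proof.
split=> [xV|/(nbhsT x)].
  have := @add_continuous E (0, x); rewrite /continuous_at /= add0r => /(_ _ xV).
  move=> [[P Q] /= [P0 Qx] PQ]; apply: filterS P0 => y Py.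
  by apply: (PQ (y, x)); split=> //; exact: nbhs_singleton.
by apply: filterS => _ [y Vy <-]; rewrite addrC.
Qed.

Section fundamental_theory.
Context {R : realType} {s : scalars}.
Local Notation K := (scalar_field R s).
Context {E : tvsType K} {p : nat -> E -> R}.
Hypothesis fp : fundamental p.
Implicit Types (x y : E) (V G : set E).

Lemma fund_le m n x : (m <= n)%N -> p m x <= p n x.
Proof.
move=> /subnK <-; elim: (n - m)%N => [|k IH] //.
by apply: le_trans IH _; rewrite addSn; exact: (fund_leS fp).
Qed.

Lemma fund_gt0 m x : x != 0 -> 0 < p m x.
Proof.
move=> x0; apply: lt_le_trans (fund_le _ (leq0n m)).
rewrite lt_neqAle semi_ge0 ?andbT; last exact: (fund_seminorm fp).
by apply: contra_neq x0 => /esym/(fund_norm fp).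
Qed.

Lemma fund_nbhsE x V : nbhs x V <->
  exists m, exists2 e, 0 < e & [set y | p m (y - x) < e] `<=` V.
Proof.
split=> [xV|[m [e e0 eV]]].
  have /(fund_nbhs fp)[m [e e0 eV]] := (nbhs_shift _ _).1 xV.
  by exists m, e => // y /= /eV /=; rewrite subrK.
apply/nbhs_shift; apply: filterS (fund_ball fp m e0) => y ye; apply: eV => /=.
by rewrite addrK.
Qed.

Lemma fund_closureP G x : closure G x <->
  forall m e, 0 < e -> exists2 y, G y & p m (y - x) < e.
Proof.
split=> [xG m e e0|xG V /fund_nbhsE[m [e e0 eV]]].
  have [|y [Gy ye]] := xG [set y | p m (y - x) < e]; last by exists y.
  by apply/fund_nbhsE; exists m, e.
by have [y Gy ye] := xG m e e0; exists y; split=> //; exact: eV.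
Qed.

Lemma fund_cvgP (u : nat -> E) x : u @ \oo --> x <->
  forall m e, 0 < e -> exists N, forall i, (N <= i)%N -> p m (u i - x) < e.
Proof.
split=> [ux m e e0|ux V /fund_nbhsE[m [e e0 eV]]].
  have [|N _ uN] := ux [set y | p m (y - x) < e]; last by exists N.
  by apply/fund_nbhsE; exists m, e.
by have [N uN] := ux m e e0; exists N => // i Ni; apply: eV; exact: uN.
Qed.

Lemma fund_eq x y : (forall e, 0 < e -> p 0%N (x - y) <= e) -> x = y.
Proof.
move=> xy; apply: subr0_eq; apply: (fund_norm fp); apply/eqP.
rewrite eq_le semi_ge0 ?andbT; last exact: (fund_seminorm fp).
by apply/ler_addgt0Pl => e e0; rewrite addr0; exact: xy.
Qed.

(** A family of seminorms whose common unit ball is a neighbourhood of zero is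
    uniformly dominated: rescale into that neighbourhood. *)
Lemma fund_dominates (I : Type) (q : I -> E -> R) : (forall i, seminorm (q i)) ->
  nbhs 0 [set x | forall i, q i x <= 1] ->
  exists m C, 0 < C /\ forall i x, q i x <= C * p m x.
Proof.
move=> sq /(fund_nbhs fp)[m [e e0 eq1]]; exists m, (2 / e).
split=> [|i x]; first by rewrite divr_gt0.
have [->|x0] := eqVneq x 0.
  by rewrite (semi0 (sq i)) (semi0 (fund_seminorm fp m)) mulr0.
have px := fund_gt0 m x0.
have [|a a0 ae] := @modulus_surj R s (e / 2 / p m x); first by rewrite !divr_gt0.
have : q i (a *: x) <= 1.
  apply: eq1; rewrite /= semiZ; last exact: (fund_seminorm fp).
  by rewrite ae divfK ?gt_eqF// ltr_pdivrMr// ltr_pMr// ltr1n.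
rewrite semiZ// ae mulrAC ler_pdivrMr// mul1r mulrC -ler_pdivlMr ?divr_gt0//.
by rewrite invf_div mulrC.
Qed.

Lemma fund_continuous (q : E -> R) m C : seminorm q ->
  (forall x, q x <= C * p m x) -> continuous q.
Proof.
move=> sq qC x; apply/cvgrPdist_lt => r r0.
have d0 : 0 < r / (`|C| + 1) by rewrite divr_gt0// ltr_wpDl.
have : nbhs x [set y | p m (y - x) < r / (`|C| + 1)].
  by apply/fund_nbhsE; exists m, (r / (`|C| + 1)).
apply: filterS => y /=; rewrite ltr_pdivlMr ?ltr_wpDl// => yr.
have qyx : q (y - x) < r.
  apply: le_lt_trans (qC _) (le_lt_trans _ yr).
  rewrite mulrC ler_wpM2l ?semi_ge0//; first exact: (fund_seminorm fp).
  by apply: le_trans (ler_norm C) _; rewrite lerDl.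
apply: le_lt_trans qyx; rewrite ler_norml; apply/andP; split.
  by rewrite lerNl opprB lerBlDr; have := semiD sq (y - x) x; rewrite subrK.
by rewrite lerBlDr (semi_distC sq); have := semiD sq (x - y) y; rewrite subrK.
Qed.

End fundamental_theory.

Lemma continuous_linear0 {R : realType} {s : scalars}
    (V W : tvsType (scalar_field R s)) (T : {linear V -> W}) :
  (forall B, nbhs 0 B -> nbhs 0 (T @^-1` B)) -> continuous T.
Proof.
move=> T0 x B TxB.
apply/nbhs_shift; have := T0 _ ((nbhs_shift _ _).1 TxB).
by apply: filterS => y /=; rewrite linearD.
Qed.

(** * Functionals on blocks of bounded dimension *)

Section finite_span.
Context {R : realType} {s : scalars}.
Local Notation K := (scalar_field R s).
Context {E : tvsType K}.
Implicit Types (x y : E) (W : set E) (q : E -> R) (l : seq E).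

(** The linear span of a finite list, built by adding one vector at a time, which
    is how subspaces are used below. *)
Fixpoint fspan l : set E :=
  if l is b :: l' then [set x | exists a : K, exists2 w, fspan l' w & x = a *: b + w]
  else [set 0].

(** Functionals are needed on the blocks only; total functions that are linear on
    a subspace avoid extending them to the whole space. *)
Definition linear_on W (f : E -> K) :=
  forall (a : K) x y, W x -> W y -> f (a *: x + y) = a * f x + f y.

Section subspace.
Context {W : set E}.
Hypothesis lW : linear_subspace W.

Lemma sub0 : W 0. Proof. by case: lW. Qed.
Lemma subZD (a : K) x y : W x -> W y -> W (a *: x + y).
Proof. by case: lW => _; exact. Qed.
Lemma subD x y : W x -> W y -> W (x + y).
Proof. by move=> Wx Wy; rewrite -[x]scale1r; exact: subZD. Qed.
Lemma subZ (a : K) x : W x -> W (a *: x).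
Proof. by move=> Wx; rewrite -[_ *: _]addr0; exact: subZD sub0. Qed.
Lemma subN x : W x -> W (- x).
Proof. by rewrite -scaleN1r; exact: subZ. Qed.
Lemma subB x y : W x -> W y -> W (x - y).
Proof. by move=> Wx Wy; exact/subD/subN. Qed.

Context {f : E -> K}.
Hypothesis lf : linear_on W f.

Lemma lin0 : f 0 = 0.
Proof.
by have := lf (-1) sub0 sub0; rewrite scaler0 addr0 mulN1r addNr.
Qed.
Lemma linD x y : W x -> W y -> f (x + y) = f x + f y.
Proof. by move=> Wx Wy; have := lf 1 Wx Wy; rewrite scale1r mul1r. Qed.
Lemma linZ (a : K) x : W x -> f (a *: x) = a * f x.
Proof. by move=> Wx; have := lf a Wx sub0; rewrite lin0 !addr0. Qed.
Lemma linN x : W x -> f (- x) = - f x.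
Proof. by move=> Wx; rewrite -scaleN1r linZ// mulN1r. Qed.
Lemma linB x y : W x -> W y -> f (x - y) = f x - f y.
Proof. by move=> Wx Wy; rewrite linD ?linN//; exact: subN. Qed.

End subspace.

Lemma fspan_subspace l : linear_subspace (fspan l).
Proof.
elim: l => [|b l [W0 WZD]]; first by split=> // a x y -> ->; rewrite scaler0 addr0.
split; first by exists 0, 0 => //; rewrite scale0r addr0.
move=> a _ _ [c [w Ww ->]] [d [v Wv ->]]; exists (a * c + d), (a *: w + v).
  exact: WZD.
by rewrite scalerDr scalerDl scalerA addrACA.
Qed.

Lemma fspan_cat0 l : fspan (rcons l 0) = fspan l.
Proof.
elim: l => [|b l /= -> //]; apply/seteqP; split=> [x [a [_ -> ->]]|x ->] /=.
  by rewrite scaler0 addr0.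
by exists 0, 0 => //; rewrite scaler0 addr0.
Qed.

Lemma fspan_sub l W : linear_subspace W -> (forall b, b \in l -> W b) ->
  fspan l `<=` W.
Proof.
move=> lW; elim: l => [_ x ->|b l IH lWb x [a [w lw ->]]]; first exact: sub0.
apply: subZD => //; first by apply: lWb; rewrite mem_head.
by apply: IH => // c cl; apply: lWb; rewrite in_cons cl orbT.
Qed.

Lemma fspan_mem l b : b \in l -> fspan l b.
Proof.
elim: l => [|c l IH]; first by rewrite in_nil.
rewrite in_cons => /predU1P[->|/IH lb].
  exists 1, 0; last by rewrite scale1r addr0.
  exact/sub0/fspan_subspace.
by exists 0, b => //; rewrite scale0r add0r.
Qed.

(** Closedness of [W] for the norm [q], expressed by positive distances. *)
Definition far q W := forall y, ~ W y ->
  exists2 c, 0 < c & forall w, W w -> c <= q (w + y).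

(** Finite-dimensional subspaces are closed for every norm; adding one vector
    [b] at a time, the coefficients of [b] along an approximating sequence form
    a Cauchy sequence of scalars. *)
Lemma fspan_far q l : seminorm q -> (forall x, q x = 0 -> x = 0) ->
  far q (fspan l).
Proof.
move=> sq qn; elim: l => [y y0|b l IH y Wy].
  exists (q y) => [|w ->]; last by rewrite add0r.
  rewrite lt_neqAle semi_ge0// andbT; apply/eqP => /esym/qn; exact: y0.
have lW := fspan_subspace l; set W := fspan l in IH lW.
have [Wb|Wb] := pselect (W b).
  have WWy : ~ W y by move=> ?; apply: Wy; exists 0, y => //; rewrite scale0r add0r.
  have [c c0 cW] := IH _ WWy; exists c => // _ [a [w Ww ->]].
  by apply: cW; exact: subZD.
have [c c0 cb] := IH _ Wb.
have ac (a : K) w : W w -> modulus a * c <= q (a *: b + w).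
  move=> Ww; have [->|a0] := eqVneq a 0; first by rewrite modulus0 mul0r semi_ge0.
  have -> : a *: b + w = a *: (a^-1 *: w + b).
    by rewrite scalerDr scalerA divff// scale1r addrC.
  by rewrite semiZ// ler_wpM2l ?modulus_ge0// cb//; exact: subZ.
apply: contrapT => nofar.
have /choice[u uP] i : exists aw : K * E, W aw.2 /\ q (aw.1 *: b + aw.2 + y) < i.+1%:R^-1.
  apply: contrapT => noi; apply: nofar; exists i.+1%:R^-1 => [|_ [a [w Ww ->]]].
    by rewrite invr_gt0.
  by rewrite leNgt; apply/negP => qi; apply: noi; exists (a, w).
have inv_lt e : 0 < e -> exists N, forall i, (N <= i)%N -> i.+1%:R^-1 < e :> R.
  move=> e0; have [N _ NP] := near_infty_natSinv_lt (PosNum e0).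
  by exists N => i Ni; exact: NP.
have [e e0|a aP] := scalar_complete (u := fun i => (u i).1).
  have ce2 : 0 < c * e / 2 by rewrite divr_gt0// mulr_gt0.
  have [N NP] := inv_lt _ ce2; exists N => i j Ni Nj.
  rewrite -(ltr_pM2r c0); apply: le_lt_trans (ac _ ((u i).2 - (u j).2) _) _.
    by apply: subB => //; exact: (uP _).1.
  have -> : ((u i).1 - (u j).1) *: b + ((u i).2 - (u j).2) =
      ((u i).1 *: b + (u i).2 + y) - ((u j).1 *: b + (u j).2 + y).
    by rewrite [in RHS]opprD [RHS]addrACA subrr addr0 scalerBl opprD addrACA.
  apply: le_lt_trans (semiB_le sq _ _) _.
  have h1 := (uP i).2; have h2 := (uP j).2; have h3 := NP i Ni.
  have h4 := NP j Nj.
  by have := ltrD (lt_trans h1 h3) (lt_trans h2 h4); rewrite -splitr mulrC.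
have Wz : ~ W (a *: b + y).
  move=> Wz; apply: Wy; exists (- a), (a *: b + y) => //.
  by rewrite addrA -scalerDl addNr scale0r add0r.
have [c1 c10 c1W] := IH _ Wz.
have qb0 := semi_ge0 sq b.
have c12 : 0 < c1 / 2 by rewrite divr_gt0.
have d0 : 0 < c1 / 2 / (q b + 1) by rewrite divr_gt0// ltr_wpDl.
have [N NP] := inv_lt _ c12; have [M MP] := aP _ d0.
pose i := maxn N M; have Ni := leq_maxl N M; have Mi := leq_maxr N M.
have := c1W _ (uP i).1; apply/negP; rewrite -ltNge.
have -> : (u i).2 + (a *: b + y) =
    ((u i).1 *: b + (u i).2 + y) - ((u i).1 - a) *: b.
  rewrite scalerBl opprB [RHS]addrC -[X in _ = _ + X]addrA [RHS]addrA subrK.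
  by rewrite addrCA.
apply: le_lt_trans (semiB_le sq _ _) _; rewrite semiZ//.
have h1 := (uP i).2; have h2 := NP _ Ni; have := MP _ Mi.
rewrite ltr_pdivlMr ?ltr_wpDl// mulrDr mulr1 => h3.
rewrite (splitr c1); apply: ltrD (lt_trans h1 h2) (le_lt_trans _ h3).
by rewrite lerDl modulus_ge0.
Qed.

(** A factor [2] replaces attainment of the distance; when [y] lies in [W] the
    distance is zero and attained. *)
Lemma near_minimizer q W y : seminorm q -> linear_subspace W -> far q W ->
  exists2 w0, W w0 & forall w, W w -> q (w0 + y) <= 2 * q (w + y).
Proof.
move=> sq lW fW; have [Wy|Wy] := pselect (W y).
  exists (- y) => [|w _]; first exact: subN.
  by rewrite addNr semi0// mulr_ge0// semi_ge0.
have [c c0 cW] := fW _ Wy.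
pose S := [set q (w + y) | w in W].
have Sinf : has_inf S.
  by split; [exists (q (0 + y)), 0 => //; exact: sub0|exists c => _ [w Ww <-]; exact: cW].
have Sc : c <= inf S by apply: lb_le_inf; [exact: Sinf.1|move=> _ [w Ww <-]; exact: cW].
have S0 : 0 < inf S by exact: lt_le_trans Sc.
have [_ [w0 Ww0 <-] w0S] := inf_adherent S0 Sinf.
exists w0 => // w Ww; apply: le_trans (ltW w0S) _.
rewrite mulr_natl mulr2n; have : inf S <= q (w + y).
  by apply: ge_inf; [exact: Sinf.2|exists w].
by move=> h; exact: lerD.
Qed.

(** Passing to the kernel of [f] along [x] removes [x] from the spanning list, which
    is what makes an induction on the length of the list possible. *)
Lemma fspan_ker l x W (f : E -> K) : linear_subspace W -> linear_on W f ->
  W x -> f x = 1 -> (forall b, b \in l -> W b) ->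
  let l' := [seq b - f b *: x | b <- l] in
  (forall y, fspan l' y -> W y /\ f y = 0) /\
  (forall y, fspan (rcons l x) y -> fspan l' (y - f y *: x)).
Proof.
move=> lW lf Wx fx; elim: l => [_|b l IH lWb] /=.
  split=> [y ->|y [a [_ -> ->]]]; first by split; [exact: sub0|exact: lin0 lW _ lf].
  by rewrite addr0 (linZ lW lf)// fx mulr1 subrr.
have Wb : W b by apply: lWb; rewrite mem_head.
have lWl c : c \in l -> W c by move=> cl; apply: lWb; rewrite in_cons cl orbT.
have [IH1 IH2] := IH lWl; split=> [_ [a [w lw ->]]|_ [a [w lw ->]]].
  have [Ww fw] := IH1 _ lw.
  have Wbx : W (b - f b *: x) by apply: subB => //; exact: subZ.
  split; first exact: subZD.
  rewrite lf// fw addr0 (linB lW lf) ?(linZ lW lf)//; last exact: subZ.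
  by rewrite fx mulr1 subrr mulr0.
have Ww : W w.
  have := fspan_sub (l := rcons l x) lW; apply=> // c; rewrite mem_rcons in_cons.
  by move=> /predU1P[->//|]; exact: lWl.
exists a, (w - f w *: x); first exact: IH2.
by rewrite lf// scalerDl scalerBr scalerA opprD addrACA.
Qed.

End finite_span.

Section tame.
Context {R : realType} {s : scalars}.
Local Notation K := (scalar_field R s).
Context {E : tvsType K} {p : nat -> E -> R}.
Hypothesis fp : fundamental p.
Context (U : set_system nat) {UU : UltraFilter U}.
Hypothesis Uinf : forall N, \forall n \near U, (N <= n)%N.

Let sp m : seminorm (p m). Proof. exact: fund_seminorm fp m. Qed.

(** The level [l] and the constant [C] depend on [m] but not on [n]. In the
    applications [alpha m n] is [p m (x n)], and then the condition says that
    [y |-> f n y *: x n] is equicontinuous on the [W n]. *)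
Definition tame (alpha : nat -> nat -> R) (W : nat -> set E) (f : nat -> E -> K) :=
  forall m, exists l C, 0 <= C /\ \forall n \near U, forall y, W n y ->
    alpha m n * modulus (f n y) <= C * p l y.

Lemma tameW alpha W W' f f' :
  (\forall n \near U, W' n `<=` W n /\ {in W' n, f n =1 f' n}) ->
  tame alpha W f -> tame alpha W' f'.
Proof.
move=> WW' tf m; have [l [C [C0 Cf]]] := tf m; exists l, C; split=> //.
apply: filterS2 WW' Cf => n [W'W ff'] Cn y W'y.
by rewrite -ff' ?inE//; apply: Cn; exact: W'W.
Qed.

Lemma tame_monotone alpha W f : tame alpha W f ->
  exists sigma : nat -> nat, {homo sigma : i j / (i <= j)%N} /\ forall m, exists C,
    0 <= C /\ \forall n \near U, forall y, W n y ->
      alpha m n * modulus (f n y) <= C * p (sigma m) y.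
Proof.
move=> /choice[sg sgP]; exists (fun m => \sum_(i < m.+1) sg i)%N; split.
  apply: homo_leq => [//|i j k|i]; first exact: leq_trans.
  by rewrite [leqRHS]big_ord_recr leq_addr.
move=> m; have [C [C0 CP]] := sgP m; exists C; split=> //.
apply: filterS CP => n Cn y Wy; apply: le_trans (Cn y Wy) _.
by rewrite ler_wpM2l// fund_le// big_ord_recr leq_addl.
Qed.

(** One-dimensional extension. At each level [m], sending [b] to minus the value
    at a near-best approximation of [- b] extends with the right bound; these
    values are reconciled by [near_center]. *)
Lemma tame_extend (alpha : nat -> nat -> R) (W : nat -> set E) (f : nat -> E -> K)
    (b : nat -> E) :
  (forall m n, 0 <= alpha m n) -> (forall n, linear_subspace (W n)) ->
  (forall m n, far (p m) (W n)) ->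
  (\forall n \near U, linear_on (W n) (f n)) -> tame alpha W f ->
  let W' n := [set x | exists a : K, exists2 w, W n w & x = a *: b n + w] in
  exists g, [/\ \forall n \near U, linear_on (W' n) (g n), tame alpha W' g &
    \forall n \near U, forall w, W n w -> g n w = f n w].
Proof.
move=> alpha0 lW fW lf tf W'.
(* The ultrafilter decides whether [b] is a new direction. *)
have [Wb|Wb] := in_ultra_setVsetC [set n | W n (b n)] UU.
  have W'W : \forall n \near U, W' n = W n.
    apply: filterS Wb => n Wb; apply/seteqP; split=> [_ [a [w Ww ->]]|w Ww].
      exact: subZD.
    by exists 0, w => //; rewrite scale0r add0r.
  exists f; split; last exact: filterE.
    by apply: filterS2 W'W lf => n ->.
  by apply: tameW tf; apply: filterS W'W => n ->; split.
have [sg [sgmono sgP]] := tame_monotone tf; have [C CP] := choice sgP.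
have /choice[w wP] : forall mn : nat * nat, exists w, W mn.2 w /\
    forall v, W mn.2 v -> p (sg mn.1) (w + b mn.2) <= 2 * p (sg mn.1) (v + b mn.2).
  move=> [m n]; have [v Wv vP] := near_minimizer (b n) (sp (sg m)) (lW n) (fW _ n).
  by exists v.
(* The distance from [b n] to [W n], up to the factor [2]. *)
pose rho j n := p (sg j) (w (j, n) + b n).
have rho0 j n : 0 <= rho j n by exact: semi_ge0.
have bound m : \forall n \near U, forall v, W n v ->
    alpha m n * modulus (f n v - f n (w (m, n))) <= 3 * C m * p (sg m) (v + b n).
  apply: filterS2 lf (CP m).2 => n lfn Cn v Wv; have [Ww wv] := wP (m, n).
  rewrite -(linB (lW n) lfn)//; apply: le_trans (Cn _ _) _; first exact: subB.
  rewrite [3 * _]mulrC -mulrA ler_wpM2l ?(CP m).1//.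
  have -> : v - w (m, n) = (v + b n) - (w (m, n) + b n).
    by rewrite opprD addrACA subrr addr0.
  apply: le_trans (semiB_le (sp _) _ _) _.
  by have /= := wv _ Wv; lra.
have [|t tP] := near_center Uinf (alpha := alpha) (rho := rho)
  (z := fun m n => - f n (w (m, n))) alpha0.
  move=> m j mj; exists (3 * C m); apply: filterS (bound m) => n bn.
  rewrite opprK addrC; apply: le_trans (bn _ (wP (j, n)).1) _.
  by rewrite ler_wpM2l ?mulr_ge0 ?(CP m).1// fund_le// sgmono.
have /choice[dec decP] : forall ny : nat * E, exists aw : K * E,
    W' ny.1 ny.2 -> W ny.1 aw.2 /\ ny.2 = aw.1 *: b ny.1 + aw.2.
  move=> [n y]; have [[a [v Wv ->]]|nW] := pselect (W' n y); first by exists (a, v).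
  by exists (0, 0) => /nW.
pose g n y := f n (dec (n, y)).2 + (dec (n, y)).1 * t n.
have gE : \forall n \near U, forall a v, W n v -> g n (a *: b n + v) = f n v + a * t n.
  apply: filterS Wb => n Wbn a v Wv; rewrite /g.
  have [|Wd] := decP (n, a *: b n + v); first by exists a, v.
  move: (dec _) Wd => [c u] /= Wu abv.
  have ac : a = c.
    apply: contra_notP Wbn => /eqP; rewrite -subr_eq0 => ac0 /=.
    have -> : b n = (a - c)^-1 *: (u - v).
      have -> : u - v = (a - c) *: b n.
        have -> : u = a *: b n + v - c *: b n by rewrite abv addrAC subrr add0r.
        by rewrite scalerBl addrAC addrK.
      by rewrite scalerA mulVf// scale1r.
    by apply: subZ => //; exact: subB.
  by move: abv; rewrite ac => /addrI ->.
exists g; split.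
- apply: filterS2 lf gE => n lfn gn a _ _ [c [u Wu ->]] [d [v Wv ->]].
  have -> : a *: (c *: b n + u) + (d *: b n + v) = (a * c + d) *: b n + (a *: u + v).
    by rewrite scalerDr scalerDl scalerA addrACA.
  rewrite !gn//; last exact: subZD.
  by rewrite lfn// mulrDl mulrDr addrACA mulrA.
- move=> m; have [l [D tD]] := tP m.
  exists (maxn (sg m) (sg l)), (3 * C m + 2 * `|D|); split.
    by rewrite addr_ge0// mulr_ge0// (CP m).1.
  apply: filterS3 (filterI lf gE) (filterI (bound m) tD) (CP m).2.
  move=> n [lfn gn] [bn tn] Cn _ [a [v Wv ->]].
  rewrite gn//; have [->|a0] := eqVneq a 0.
    rewrite mul0r addr0 scale0r add0r; apply: le_trans (Cn _ Wv) _.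
    apply: ler_pM; rewrite ?(CP m).1 ?semi_ge0//.
      by have h1 := (CP m).1; have h2 := normr_ge0 D; lra.
    by rewrite fund_le// leq_maxl.
  have Wv' : W n (a^-1 *: v) by exact: subZ.
  have -> : f n v + a * t n = a * (f n (a^-1 *: v) + t n).
    by rewrite (linZ (lW n) lfn)// mulrDr mulVKf.
  have -> : a *: b n + v = a *: (a^-1 *: v + b n).
    by rewrite scalerDr scalerA divff// scale1r addrC.
  rewrite modulusM semiZ// mulrCA [leRHS]mulrCA ler_wpM2l ?modulus_ge0//.
  set q := p (maxn _ _) _.
  have h1 := bn _ Wv'; have h3 := (wP (l, n)).2 _ Wv'.
  have h2 : alpha m n * modulus (t n + f n (w (m, n))) <= `|D| * rho l n.
    by move: tn; rewrite opprK => /le_trans; apply; rewrite ler_wpM2r// ler_norm.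
  have h4 : p (sg m) (a^-1 *: v + b n) <= q by rewrite fund_le// leq_maxl.
  have h5 : p (sg l) (a^-1 *: v + b n) <= q by rewrite fund_le// leq_maxr.
  have h6 : modulus (f n (a^-1 *: v) + t n) <=
      modulus (f n (a^-1 *: v) - f n (w (m, n))) + modulus (t n + f n (w (m, n))).
    by apply: le_trans (modulusD _ _); rewrite addrACA addNr addr0 addrC.
  apply: le_trans (ler_wpM2l (alpha0 m n) h6) _; rewrite mulrDr mulrDl; apply: lerD.
    by apply: le_trans h1 _; rewrite ler_wpM2l// mulr_ge0// (CP m).1.
  apply: le_trans h2 _; rewrite [2 * _]mulrC -mulrA ler_wpM2l//.
  by apply: le_trans h3 _; rewrite ler_wpM2l.
- apply: filterS gE => n gn v Wv.
  by have := gn 0 v Wv; rewrite scale0r add0r mul0r addr0.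
Qed.

Definition spanned (bs : seq (nat -> E)) n : set E := fspan [seq b n | b <- bs].

Lemma spanned_subspace bs n : linear_subspace (spanned bs n).
Proof. exact: fspan_subspace. Qed.

Lemma spanned_far bs m n : far (p m) (spanned bs n).
Proof.
apply: fspan_far => // x px; apply: contraPP (px) => /eqP/(fund_gt0 fp m) => px0.
by apply/eqP; rewrite gt_eqF.
Qed.

(** The functional is determined on the line of [x n], and [tame_extend] adds the
    vectors of [bs] one by one. *)
Lemma tame_functional (bs : seq (nat -> E)) (x : nat -> E) :
  (\forall n \near U, x n != 0) ->
  exists f, [/\ \forall n \near U, linear_on (spanned (rcons bs x) n) (f n),
    \forall n \near U, f n (x n) = 1 &
    tame (fun m n => p m (x n)) (spanned (rcons bs x)) f].
Proof.
move=> x0; elim: bs => [|b bs [f [lf fx tf]]].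
  have /choice[g gP] : forall ny : nat * E, exists a : K,
      spanned [:: x] ny.1 ny.2 -> ny.2 = a *: x ny.1.
    move=> [n y]; have [[a [_ -> ->]]|nW] := pselect (spanned [:: x] n y).
      by exists a => _; rewrite addr0.
    by exists 0 => /nW.
  have gx n a : x n != 0 -> g (n, a *: x n) = a.
    move=> xn0; have : spanned [:: x] n (a *: x n).
      by exists a, 0 => //; rewrite addr0.
    move/(gP (n, _)) => /= /eqP; rewrite -subr_eq0 -scalerBl scaler_eq0 subr_eq0.
    by rewrite (negPf xn0) orbF => /eqP/esym.
  exists (fun n y => g (n, y)); split.
  - apply: filterS x0 => n xn0 a _ _ [c [_ -> ->]] [d [_ -> ->]].
    by rewrite !addr0 scalerA -scalerDl !gx.
  - by apply: filterS x0 => n xn0; have := gx n 1 xn0; rewrite scale1r.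
  - move=> m; exists m, 1; split=> //; apply: filterS x0 => n xn0 _ [c [_ -> ->]].
    by rewrite addr0 gx// semiZ// mul1r mulrC.
have [|||||g [lg tg gf]] := @tame_extend (fun m n => p m (x n)) (spanned (rcons bs x)) f b.
- by move=> m n; exact: semi_ge0.
- exact: spanned_subspace.
- exact: spanned_far.
- exact: lf.
- exact: tf.
exists g; split=> //; apply: filterS2 gf fx => n -> //.
by apply: fspan_mem; rewrite map_rcons mem_rcons mem_head.
Qed.

Definition adapted_basis (W : nat -> set E) d (e : nat -> nat -> E)
    (f : nat -> nat -> E -> K) :=
  (\forall n \near U, [/\ forall i, (i < d)%N -> W n (e i n),
    forall i, (i < d)%N -> linear_on (W n) (f i n),
    forall i j, (i < d)%N -> (j < d)%N -> f i n (e j n) = (i == j)%:R &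
    forall y, W n y -> y = \sum_(i < d) f i n y *: e i n]) /\
  forall i, (i < d)%N -> tame (fun m n => p m (e i n)) W (f i).

(** Split off the last spanning vector with a tame functional, and continue in
    the kernel of that functional. *)
Lemma adapted_basis_exists (bs : seq (nat -> E)) :
  exists d e f, adapted_basis (spanned bs) d e f.
Proof.
have [N] := ubnP (size bs); elim: N bs => // N IH bs.
case/lastP: bs => [_|bs x].
  exists 0%N, (fun _ _ => 0), (fun _ _ _ => 0); split=> //.
  by apply: filterE => n; split=> // y ->; rewrite big_ord0.
rewrite size_rcons ltnS => sbs.
have [x0|x0] := in_ultra_setVsetC [set n | x n = 0] UU.
  have [d [e [f [ef tf]]]] := IH _ sbs; exists d, e, f.
  have WW : \forall n \near U, spanned (rcons bs x) n = spanned bs n.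
    by apply: filterS x0 => n xn0; rewrite /spanned map_rcons xn0 fspan_cat0.
  split=> [|i id]; first by apply: filterS2 WW ef => n ->.
  by apply: tameW (tf i id); apply: filterS WW => n ->; split.
have {}x0 : \forall n \near U, x n != 0 by apply: filterS x0 => n /eqP.
have [phi [lphi phix tphi]] := tame_functional bs x0.
pose bs' := [seq (fun n => b n - phi n (b n) *: x n) | b <- bs].
have [|d [e [f [ef tf]]]] := IH bs'; first by rewrite size_map.
set W := spanned (rcons bs x) in lphi tphi *; set W' := spanned bs' in ef tf.
have Wx n : W n (x n) by apply: fspan_mem; rewrite map_rcons mem_rcons mem_head.
have ker : \forall n \near U, (forall y, W' n y -> W n y /\ phi n y = 0) /\
    (forall y, W n y -> W' n (y - phi n y *: x n)).
  apply: filterS2 lphi phix => n lphin phixn.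
  have := fspan_ker (l := [seq b n | b <- bs]) (spanned_subspace _ n) lphin (Wx n) phixn.
  rewrite /W /W' /spanned map_rcons /bs' -!map_comp; apply=> c cl.
  by apply: fspan_mem; rewrite mem_rcons in_cons cl orbT.
exists d.+1, (fun i n => if i is i'.+1 then e i' n else x n),
  (fun i n y => if i is i'.+1 then f i' n (y - phi n y *: x n) else phi n y).
split.
  apply: filterS2 (filterI lphi phix) (filterI ker ef).
  move=> n [lphin phixn] [[k1 k2] [We lfn fe ye]].
  have lW := spanned_subspace (rcons bs x) n; have lW' := spanned_subspace bs' n.
  split.
  - by case=> [|i] //; rewrite ltnS => /We/k1[].
  - case=> [_|i]; rewrite ?ltnS; first exact: lphin.
    move=> id a u v Wu Wv; rewrite lphin// -lfn//; [|exact: k2..].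
    by congr f; rewrite scalerDl scalerBr scalerA opprD addrACA.
  - case=> [|i] [|j]; rewrite ?ltnS => id jd /=.
    + by rewrite phixn.
    + by have [_ ->] := k1 _ (We _ jd).
    + by rewrite phixn scale1r subrr; exact: lin0 lW' _ (lfn _ id).
    + by have [_ ->] := k1 _ (We _ jd); rewrite scale0r subr0 fe.
  - move=> y Wy; rewrite big_ord_recl /=; have := ye _ (k2 _ Wy).
    by move=> <-; rewrite subrKC.
case=> [_|i]; rewrite ?ltnS; first exact: tphi.
move=> id m; have [l [C [C0 CP]]] := tf _ id m; have [l' [C' [C'0 CP']]] := tphi l.
exists (maxn l l'), (C * (1 + C')); split; first by rewrite mulr_ge0// addr_ge0.
apply: filterS3 CP CP' ker => n Cn Cn' [_ k2] y Wy.
apply: le_trans (Cn _ (k2 _ Wy)) _; rewrite -mulrA ler_wpM2l//.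
apply: le_trans (semiB_le (sp _) _ _) _; rewrite mulrDl mul1r semiZ//; apply: lerD.
  by rewrite fund_le// leq_maxl.
rewrite mulrC; apply: le_trans (Cn' _ Wy) _.
by rewrite ler_wpM2l// fund_le// leq_maxr.
Qed.

End tame.

(** * Decay along blocks in Montel spaces *)

Section montel_blocks.
Context {R : realType} {s : scalars}.
Local Notation K := (scalar_field R s).
Context {E : tvsType K} {p : nat -> E -> R}.
Hypothesis fp : fundamental p.
Context {A : nat -> {linear E -> E}}.
Hypotheses (Acont : forall n, continuous (A n))
  (AA : forall m n x, A n (A m x) = if m == n then A n x else 0)
  (Acvg : forall x, series (fun n => A n x) @ \oo --> x).

Let sp m : seminorm (p m). Proof. exact: fund_seminorm fp m. Qed.

Lemma block_id n x : block A n x -> A n x = x.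
Proof. by move=> [y _ <-]; rewrite AA eqxx. Qed.

Lemma block_orth n m x : block A n x -> n != m -> A m x = 0.
Proof. by move=> [y _ <-] /negPf nm; rewrite AA nm. Qed.

Lemma block_subspace n : linear_subspace (block A n).
Proof.
split; first by exists 0 => //; rewrite linear0.
by move=> a _ _ [x _ <-] [y _ <-]; exists (a *: x + y) => //; rewrite linearP.
Qed.

Lemma seminorm_block m n : seminorm (fun x => p m (A n x)).
Proof.
split=> [x|x y|a x]; first exact: semi_ge0.
  by rewrite linearD semiD.
by rewrite linearZ semiZ.
Qed.

(** The blocks of [x] are differences of consecutive partial sums of a convergent
    series. *)
Lemma block_bounded m x : exists D, 0 < D /\ forall n, p m (A n x) <= D.
Proof.
have [N NP] := (fund_cvgP fp _ _).1 (@Acvg x) m 1 ltr01.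
pose D := \sum_(n < N) p m (A n x); have D0 : 0 <= D.
  by apply: sumr_ge0 => i _; exact: semi_ge0.
exists (2 + D); split=> [|n]; first by rewrite ltr_wpDr.
have [Nn|nN] := leqP N n; last first.
  rewrite /D (bigD1 (Ordinal nN))//= addrCA lerDl addr_ge0//.
  by apply: sumr_ge0 => i _; exact: semi_ge0.
have -> : A n x = (series (fun n => A n x) n.+1 - x) - (series (fun n => A n x) n - x).
  by rewrite opprB addrA subrK seriesSB.
apply: le_trans (semiB_le (sp m) _ _) _; rewrite ler_wpDr//.
by apply: lerD; apply: ltW; apply: NP => //; exact: leqW.
Qed.

(** Pointwise boundedness of the [A n] becomes equicontinuity: the common unit
    ball of the seminorms [p m \o A n] is a barrel. *)
Lemma block_equicontinuous : barrelled E -> forall m,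
  exists l C, 0 < C /\ forall n x, p m (A n x) <= C * p l x.
Proof.
move=> bE m; apply: (fund_dominates fp (q := fun n x => p m (A n x))).
  by move=> n; exact: seminorm_block.
apply: bE.
- move=> x Bx n; apply/ler_addgt0Pl => e e0.
  have [|y [By ye]] := Bx [set y | p m (A n y - A n x) < e].
    apply: (@Acont n x [set z | p m (z - A n x) < e]).
    by apply/(fund_nbhsE fp); exists m, e.
  have -> : A n x = - (A n y - A n x) + A n y by rewrite opprB subrK.
  by apply: le_trans (semiD (sp m) _ _) _; rewrite semiN// lerD ?By// ltW.
- apply/convex_setP => t x y t0 t1 Bx By n; rewrite linearD !linearZ.
  apply: le_trans (semiD (sp m) _ _) _; rewrite !semiZ//.
  have t10 : 0 <= 1 - t by rewrite subr_ge0.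
  have -> : 1 = modulus t + modulus (1 - t).
    by rewrite -modulusD_ge0// addrC subrK modulus1.
  by apply: lerD; rewrite ler_piMr ?modulus_ge0//; [exact: Bx|exact: By].
- move=> a x; rewrite modulus_le1 => a1 Bx n; rewrite linearZ semiZ//.
  by rewrite -[leRHS]mulr1 ler_pM ?modulus_ge0 ?semi_ge0//; exact: Bx.
- move=> x; have [D [D0 DP]] := block_bounded m x.
  have [|r r0 rD] := @modulus_surj R s D^-1; first by rewrite invr_gt0.
  exists r => // a; rewrite -{1}(gtr0_norm r0) le_modulus rD => aD n.
  rewrite linearZ semiZ//; apply: le_trans (_ : D^-1 * D <= _).
    by apply: ler_pM; rewrite ?modulus_ge0 ?semi_ge0//; exact: DP.
  by rewrite mulVf// gt_eqF.
Qed.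

Section ultrafilter.
Context {U : set_system nat} {UU : UltraFilter U}.
Hypothesis Uinf : forall N, \forall n \near U, (N <= n)%N.

(** Otherwise the normalized vectors would form a bounded sequence, hence have a
    cluster point; all of its components vanish, yet its [p m]-norm is [1]. *)
Lemma montel_decay (e : nat -> E) : montel E ->
  (\forall n \near U, block A n (e n) /\ e n != 0) ->
  forall m, exists m', forall d, 0 < d -> \forall n \near U,
    p m (e n) <= d * p m' (e n).
Proof.
move=> [_ _ mE] eU m; apply: contrapT => nodecay.
have /choice[d dP] m' : exists d, 0 < d /\ \forall n \near U, d * p m' (e n) < p m (e n).
  apply: contrapT => nod; apply: nodecay; exists m' => d d0.
  apply: contrapT => /not_near nP; apply: nod; exists d; split=> //.
  by apply: filterS nP => n /negP; rewrite -ltNge.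
have [|nu [numono nuP]] := near_subsequence Uinf (Q := fun r n =>
    (block A n (e n) /\ e n != 0) /\
    forall i, (i <= r)%N -> d i * p i (e n) < p m (e n)).
  move=> r; apply: filterI eU _; apply: near_leq => i; exact: (dP i).2.
have pe r : 0 < p m (e (nu r)) by apply: fund_gt0 => //; have [[]] := nuP r.
have /choice[a aP] r : exists a : K, modulus a = (p m (e (nu r)))^-1.
  by have [|a _ am] := @modulus_surj R s (p m (e (nu r)))^-1; [rewrite invr_gt0|exists a].
pose y r := a r *: e (nu r).
have yb i : exists D, 0 < D /\ forall r, p i (y r) <= D.
  exists ((d i)^-1 + \sum_(r < i) p i (y r)).
  have S0 : 0 <= \sum_(r < i) p i (y r) by apply: sumr_ge0 => r _; exact: semi_ge0.
  have di0 : 0 < (d i)^-1 by rewrite invr_gt0 (dP i).1.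
  split=> [|r]; first by rewrite ltr_wpDr.
  have [ir|ri] := leqP i r; last first.
    rewrite (bigD1 (Ordinal ri))//= addrCA lerDl addr_ge0 ?(ltW di0)//.
    by apply: sumr_ge0 => j _; exact: semi_ge0.
  apply: ler_wpDr => //; rewrite semiZ// aP mulrC ler_pdivrMr// mulrC.
  by rewrite ler_pdivlMr ?(dP i).1// mulrC ltW// (nuP r).2.
have Ybd : tvs_bounded (range y).
  move=> V /(fund_nbhs fp)[i [c c0 cV]]; have [D [D0 DP]] := yb i.
  have [|b b0 bD] := @modulus_surj R s (2 * D / c); first by rewrite divr_gt0// mulr_gt0.
  have bn0 : b != 0 by rewrite gt_eqF.
  exists b => // _ [r _ <-]; exists (b^-1 *: y r); last by rewrite scalerA divff// scale1r.
  apply: cV => /=; rewrite semiZ// modulusV bD invf_div.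
  rewrite mulrAC ltr_pdivrMr ?mulr_gt0// ltr_pM2l//.
  by apply: le_lt_trans (DP r) _; rewrite ltr_pMl// ltr1n.
have yF : (y @ \oo) (closure (range y)).
  by exists 0%N => // r _; apply: subset_closure; exists r.
have [z [_ zy]] := mE _ Ybd (y @ \oo) _ yF.
have zc V N : nbhs z V -> exists r, (N <= r)%N /\ V (y r).
  move=> zV; have [|_ [[r Nr <-] Vr]] := zy (y @` [set r | (N <= r)%N]) V _ zV.
    by exists N => // r Nr; exists r.
  by exists r.
have Az l : A l z = 0.
  apply: (fund_eq fp) => c c0; rewrite subr0.
  have [|r [lr /= yr]] := zc [set w | p 0%N (A l w - A l z) < c] l.+1.
    apply: (@Acont l z [set w | p 0%N (w - A l z) < c]).
    by apply/(fund_nbhsE fp); exists 0%N, c.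
  move: yr; rewrite /y linearZ (block_orth (nuP r).1.1); last first.
    rewrite gt_eqF//; apply: leq_trans lr _.
    by elim: (r) => // k IH; apply: leq_ltn_trans IH _; exact: numono.
  by rewrite /= scaler0 sub0r semiN// => /ltW.
have z0 : z = 0.
  apply: (fund_eq fp) => c c0; rewrite subr0.
  have [N NP] := (fund_cvgP fp _ _).1 (@Acvg z) 0%N c c0.
  have := NP N (leqnn N); rewrite /series /= big1 => [|i _]; last exact: Az.
  by rewrite sub0r semiN// => /ltW.
have [|r [_ /=]] := zc [set w | p m (w - z) < 1] 0%N.
  by apply/(fund_nbhsE fp); exists m, 1.
by rewrite z0 subr0 /y semiZ// aP mulVf ?ltxx// gt_eqF.
Qed.

(** Tameness at the level [m'] given by [montel_decay], and equicontinuity of the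
    [A n], make [p m (e i n) * modulus (f i n (A n y))] smaller than any positive
    multiple of a fixed norm of [y] for most [n]; the [r]-th selected block is chosen to
    satisfy this for the levels up to [r]. The finitely many earlier blocks are
    absorbed in the constant by comparing with level [0]. The vectors of the
    selected blocks are enumerated as [j = r * d + i]. *)
Lemma nuclear_subsystem (G : nat -> Prop) d (e : nat -> nat -> E)
    (f : nat -> nat -> E -> K) : montel E -> (0 < d)%N ->
  (\forall n \near U, [/\ G n, forall i, (i < d)%N -> block A n (e i n),
    forall i, (i < d)%N -> linear_on (block A n) (f i n) &
    forall i j, (i < d)%N -> (j < d)%N -> f i n (e j n) = (i == j)%:R]) ->
  (forall i, (i < d)%N -> tame (p := p) U (fun m n => p m (e i n)) (block A) (f i)) ->
  exists nu : nat -> nat, [/\ {homo nu : i j / (i < j)%N},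
    forall r, [/\ G (nu r), forall i, (i < d)%N -> block A (nu r) (e i (nu r)),
      forall i, (i < d)%N -> linear_on (block A (nu r)) (f i (nu r)) &
      forall i j, (i < d)%N -> (j < d)%N -> f i (nu r) (e j (nu r)) = (i == j)%:R] &
    forall m, exists l D, 0 <= D /\ forall j y,
      p m (e (j %% d) (nu (j %/ d)))%N *
        modulus (f (j %% d) (nu (j %/ d)) (A (nu (j %/ d)) y))%N <=
      D * 2^-1 ^+ j * p l y].
Proof.
move=> mE d0 good tf; have [_ bE _] := mE.
have en0 i : (i < d)%N -> \forall n \near U, block A n (e i n) /\ e i n != 0.
  move=> id; apply: filterS good => n [_ be lf fe]; split; first exact: be.
  apply/eqP => e0; have := fe _ _ id id; rewrite e0 eqxx => /eqP.
  by rewrite (lin0 (block_subspace n) (lf _ id)) eq_sym oner_eq0.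
have /choice[tau0 tau0P] : forall mi : nat * nat, exists l, (mi.2 < d)%N ->
    forall c, 0 < c -> \forall n \near U, forall y,
    p mi.1 (e mi.2 n) * modulus (f mi.2 n (A n y)) <= c * p l y.
  move=> [m i] /=; have [id|] := boolP (i < d)%N; last by exists 0%N.
  have [m' m'P] := montel_decay mE (en0 _ id) m.
  have [l [C [C0 CP]]] := tf _ id m'.
  have [l' [C' [C'0 CP']]] := block_equicontinuous bE l.
  exists l' => _ c c0.
  have c'0 : 0 < c / (C * C' + 1) by rewrite divr_gt0// ltr_wpDl// mulr_ge0// ltW.
  apply: filterS2 (m'P _ c'0) CP => n en Cn y.
  apply: le_trans (ler_wpM2r (modulus_ge0 _) en) _; rewrite -mulrA.
  have bAy : block A n (A n y) by exists y.
  apply: le_trans (ler_wpM2l (ltW c'0) (Cn _ bAy)) _.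
  apply: le_trans (_ : c / (C * C' + 1) * (C * (C' * p l' y)) <= _).
    by rewrite ler_wpM2l ?(ltW c'0)// ler_wpM2l//; exact: CP'.
  rewrite !mulrA ler_wpM2r ?semi_ge0// -!mulrA ger_pMr//.
  by rewrite mulrC ler_pdivrMr ?mul1r ?lerDl// ltr_wpDl// mulr_ge0// ltW.
pose tau m := (\sum_(i < d) tau0 (m, (i : nat)))%N.
have tauP m i c : (i < d)%N -> 0 < c -> \forall n \near U, forall y,
    p m (e i n) * modulus (f i n (A n y)) <= c * p (tau m) y.
  move=> id c0; apply: filterS (tau0P (m, i) id c c0) => n tn y.
  apply: le_trans (tn y) _; rewrite ler_wpM2l ?(ltW c0)// fund_le//.
  by rewrite /tau (bigD1 (Ordinal id))//= leq_addr.
have half0 k : 0 < 2^-1 ^+ k :> R by rewrite exprn_gt0// invr_gt0.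
(* All [j] of the [r]-th block satisfy [j < r.+1 * d]. *)
have [|nu [numono nuP]] := near_subsequence Uinf (Q := fun r n =>
    [/\ G n, forall i, (i < d)%N -> block A n (e i n),
    forall i, (i < d)%N -> linear_on (block A n) (f i n) &
    forall i j, (i < d)%N -> (j < d)%N -> f i n (e j n) = (i == j)%:R] /\
    forall m, (m <= r)%N -> forall i, (i <= d)%N -> (i < d)%N -> forall y,
      p m (e i n) * modulus (f i n (A n y)) <= 2^-1 ^+ (r.+1 * d) * p (tau m) y).
  move=> r; apply: filterI good _; apply: near_leq => m; apply: near_leq => i.
  have [id|] := boolP (i < d)%N; last by move=> _; exact: filterE.
  by apply: filterS (tauP m i _ id (half0 (r.+1 * d)%N)) => n tn _.
exists nu; split=> // [r|m]; first exact: (nuP r).1.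
have p0 r i : (i < d)%N -> 0 < p 0%N (e i (nu r)).
  move=> id; have [[_ be lf fe] _] := nuP r; apply: fund_gt0 => //.
  apply/eqP => e0; have := fe _ _ id id; rewrite e0 eqxx => /eqP.
  by rewrite (lin0 (block_subspace _) (lf _ id)) eq_sym oner_eq0.
pose ratio r i := p m (e i (nu r)) / p 0%N (e i (nu r)).
have ratio0 r i : 0 <= ratio r i by rewrite divr_ge0// semi_ge0.
exists (maxn (tau m) (tau 0%N)), (1 + \sum_(r < m) \sum_(i < d) ratio r i).
have S0 : 0 <= \sum_(r < m) \sum_(i < d) ratio r i.
  by apply: sumr_ge0 => r _; apply: sumr_ge0.
split=> [|j y]; first by rewrite addr_ge0.
set i := (j %% d)%N; set r := (j %/ d)%N; set n := nu r.
have id : (i < d)%N by rewrite ltn_mod.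
have jr : (j <= r.+1 * d)%N by rewrite ltnW// -ltn_divLR.
have halfle : 2^-1 ^+ (r.+1 * d) <= 2^-1 ^+ j :> R.
  by rewrite ler_wiXn2l// ?invr_ge0// invf_le1// ler1n.
have [_ bound] := nuP r.
have [mr|rm] := leqP m r.
  apply: le_trans (bound _ mr _ (ltnW id) id y) _.
  apply: ler_pM; rewrite ?semi_ge0 ?(ltW (half0 _))//.
    by rewrite -[leLHS]mul1r ler_pM// ?(ltW (half0 _))// lerDl.
  by rewrite fund_le// leq_maxl.
have -> : p m (e i n) = ratio r i * p 0%N (e i n).
  by rewrite /ratio divfK// gt_eqF// p0.
rewrite -mulrA; apply: le_trans (ler_wpM2l (ratio0 r i) (bound _ (leq0n r) _ (ltnW id) id y)) _.
rewrite mulrA; apply: ler_pM; rewrite ?semi_ge0 ?(mulr_ge0 (ratio0 _ _) (ltW (half0 _)))//.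
  apply: (ler_pM (ratio0 _ _) (ltW (half0 _)) _ halfle).
  rewrite (bigD1 (Ordinal rm))//= (bigD1 (Ordinal id))//= addrCA -addrA lerDl.
  by rewrite !addr_ge0// ?sumr_ge0// => k _; apply: sumr_ge0.
by rewrite fund_le// leq_maxr.
Qed.

End ultrafilter.
End montel_blocks.

(** * Series, closed spans and Koethe norms *)

Lemma linear_of_fun (K : numFieldType) (V W : tvsType K) (T : V -> W) :
  (forall (a : K) x y, T (a *: x + y) = a *: T x + T y) ->
  exists g : {linear V -> W}, g =1 T.
Proof.
move=> lT; pose M := GRing.isLinear.Build K V W _ T lT.
by pose g : {linear V -> W} := HB.pack T M; exists g.
Qed.

Lemma cvg_comb (K : numFieldType) (V : tvsType K) (u v : nat -> V) (x y : V) (a : K) :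
  u @ \oo --> x -> v @ \oo --> y -> (fun n => a *: u n + v n) @ \oo --> a *: x + y.
Proof.
move=> ux vy.
have aux : (fun n => a *: u n) @ \oo --> a *: x.
  apply: (cvg_comp (fun n => (a, u n)) (fun z : K^o * V => z.1 *: z.2) _
    (@scale_continuous _ V (a, x))).
  by apply: (@cvg_pair _ _ _ _ (nbhs (a : K^o))); [exact: cvg_cst|exact: ux].
apply: (cvg_comp (fun n => (a *: u n, v n)) (fun z : V * V => z.1 + z.2) _
  (@add_continuous V (a *: x, y))).
exact: cvg_pair.
Qed.

Lemma bounded_sum_cauchy (R : realType) (u : nat -> R) (B : R) :
  (forall j, 0 <= u j) -> (forall n, \sum_(j < n) u j <= B) ->
  forall c, 0 < c -> exists N, forall n, (N <= n)%N ->
    \sum_(j < n) u j - \sum_(j < N) u j < c.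
Proof.
move=> u0 uB c c0; pose S := range (fun n => \sum_(j < n) u j).
have Ssup : has_sup S.
  by split; [exists (\sum_(j < 0) u j), 0%N|exists B => _ [n _ <-]].
have [_ [N _ <-] NS] := sup_adherent c0 Ssup.
exists N => n Nn; rewrite ltrBlDr -ltrBlDl; apply: le_lt_trans NS.
by rewrite lerD2r; apply: sup_upper_bound => //; exists n.
Qed.

Lemma sum_geometric_half (R : realType) (D : R) n : 0 <= D ->
  \sum_(j < n) D * 2^-1 ^+ j <= 2 * D.
Proof.
move=> D0; have h : `|2^-1| < 1 :> R.
  by rewrite ger0_norm ?invr_ge0// invf_lt1// ltr1n.
have := @geometric_le_lim R n D 2^-1 D0; rewrite invr_gt0 ltr0n => /(_ isT h).
have -> : (1 - 2^-1)^-1 = 2 :> R.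
  by rewrite [X in X - _](splitr 1) mul1r addrK invrK.
by rewrite mulrC /series /= big_mkord.
Qed.

Section summable_series.
Context {R : realType} {s : scalars}.
Local Notation K := (scalar_field R s).
Context {E : tvsType K} {p : nat -> E -> R}.
Hypotheses (fp : fundamental p) (Ec : tvs_complete E).

Let sp m : seminorm (p m). Proof. exact: fund_seminorm fp m. Qed.

Lemma series_diff_le m (u : nat -> E) i j : (i <= j)%N ->
  p m (series u j - series u i) <= \sum_(k < j) p m (u k) - \sum_(k < i) p m (u k).
Proof.
move=> ij; rewrite sub_series_geq//.
rewrite -!(big_mkord xpredT (fun k => p m (u k))) (big_cat_nat (leq0n i) ij)//=.
by rewrite addrAC subrr add0r; exact: semi_sum.
Qed.

Lemma series_seminorm_le m (u : nat -> E) i :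
  p m (series u i) <= \sum_(k < i) p m (u k).
Proof. by rewrite /series /= big_mkord; exact: semi_sum. Qed.

Lemma abs_series_cvg (u : nat -> E) :
  (forall m, exists B, forall n, \sum_(j < n) p m (u j) <= B) ->
  exists x : E, series u @ \oo --> x.
Proof.
move=> uB; apply: (@Ec (series u @ \oo)) => V V0; have [m [c c0 cV]] := fund_nbhs fp V0.
have [B uB'] := uB m; have c2 : 0 < c / 2 by rewrite divr_gt0.
have [N NP] := bounded_sum_cauchy (u := fun j => p m (u j)) (fun j => semi_ge0 (sp m) _) uB' c2.
exists (series u @` [set i | (N <= i)%N]); first by exists N => // i Ni; exists i.
move=> _ _ [i Ni <-] [j Nj <-]; apply: cV => /=.
apply: le_lt_trans (semiB (sp m) (series u N) _ _) _; rewrite (splitr c).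
rewrite (semi_distC (sp m) (series u N)).
by apply: ltrD; apply: le_lt_trans (series_diff_le _ _ _) _ => //; exact: NP.
Qed.

Lemma cvg_seminorm_le m (v : nat -> E) (x : E) B :
  v @ \oo --> x -> (forall n, p m (v n) <= B) -> p m x <= B.
Proof.
move=> vx vB; apply/ler_addgt0Pl => c c0.
have [N NP] := (fund_cvgP fp _ _).1 vx m c c0.
have -> : x = - (v N - x) + v N by rewrite opprB subrK.
by apply: le_trans (semiD (sp m) _ _) _; rewrite semiN// lerD// ltW// NP.
Qed.

Lemma fund_cvg_unique (v : nat -> E) (x y : E) : v @ \oo --> x -> v @ \oo --> y -> x = y.
Proof.
move=> vx vy; apply: (fund_eq fp) => c c0; have c2 : 0 < c / 2 by rewrite divr_gt0.
have [N NP] := (fund_cvgP fp _ _).1 vx 0%N _ c2.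
have [M MP] := (fund_cvgP fp _ _).1 vy 0%N _ c2.
apply: le_trans (semiB (sp 0%N) (v (maxn N M)) _ _) _.
rewrite (semi_distC (sp 0%N) x) (splitr c) ltW// ltrD//.
  by apply: NP; exact: leq_maxl.
by apply: MP; exact: leq_maxr.
Qed.

Lemma closed_span_min (G H : set E) : linear_subspace H -> closed H ->
  G `<=` H -> closed_span G `<=` H.
Proof.
move=> lH cH GH; apply: subset_trans cH.
apply: closure_subset => x [n [c [v [Gv ->]]]].
elim/big_ind : _ => [|y z|i _]; first exact: sub0.
  exact: subD.
by apply: subZ => //; exact/GH/Gv.
Qed.

Lemma lin_span_subspace (G : set E) : linear_subspace (lin_span G).
Proof.
split; first by exists 0%N, (fun=> 0), (fun=> 0); split=> [[]//|]; rewrite big_ord0.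
move=> a _ _ [n [c [v [Gv ->]]]] [n' [c' [v' [Gv' ->]]]].
exists (n + n')%N, (fun i => match fintype.split i with inl j => a * c j | inr j => c' j end),
  (fun i => match fintype.split i with inl j => v j | inr j => v' j end); split.
  by move=> i; case: (fintype.split i).
rewrite big_split_ord /= scaler_sumr; congr (_ + _); apply: eq_bigr => i _.
  by rewrite (unsplitK (inl i)) scalerA.
by rewrite (unsplitK (inr i)).
Qed.

Lemma closure_subspace (G : set E) : linear_subspace G -> linear_subspace (closure G).
Proof.
move=> lG; split; first by apply: subset_closure; exact: sub0.
move=> a x y xG yG; apply/(fund_closureP fp) => m c c0.
have c2 : 0 < c / 2 by rewrite divr_gt0.
have d0 : 0 < c / 2 / (modulus a + 1) by rewrite divr_gt0// ltr_wpDl ?modulus_ge0.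
have [x' Gx' xx'] := (fund_closureP fp _ _).1 xG m _ d0.
have [y' Gy' yy'] := (fund_closureP fp _ _).1 yG m _ c2.
exists (a *: x' + y'); first exact: subZD.
have -> : a *: x' + y' - (a *: x + y) = a *: (x' - x) + (y' - y).
  by rewrite opprD addrACA scalerBr.
apply: le_lt_trans (semiD (sp m) _ _) _; rewrite semiZ// (splitr c).
apply: ler_ltD yy'; move: xx'; rewrite ltr_pdivlMr ?ltr_wpDl ?modulus_ge0// => xx'.
by apply: le_trans (ltW xx'); rewrite mulrC ler_wpM2l ?semi_ge0// lerDl.
Qed.

Lemma closed_span_subspace (G : set E) : linear_subspace (closed_span G).
Proof. exact/closure_subspace/lin_span_subspace. Qed.

Lemma closed_span_closed (G : set E) : closed (closed_span G).
Proof. exact: closed_closure. Qed.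

Lemma sub_closed_span (G : set E) : G `<=` closed_span G.
Proof.
move=> x Gx; apply: subset_closure; exists 1%N, (fun=> 1), (fun=> x); split=> //.
by rewrite big_ord1 scale1r.
Qed.

End summable_series.

Section kothe.
Context {R : realType} {s : scalars} (a : kothe_matrix R).
Local Notation K := (scalar_field R s).
Local Notation L := (lambda s a).
Implicit Types (xi : nat -> K^o).

Lemma kothe_norm_le m xi B :
  (forall n, \sum_(j < n) modulus (xi j : K) * a j m <= B) ->
  (kothe_norm a m xi <= B%:E)%E.
Proof.
move=> xiB; apply: lime_le.
  by apply: is_cvg_nneseries => n _ _; rewrite lee_fin mulr_ge0 ?modulus_ge0 ?kothe_ge0.
by apply: nearW => n; rewrite sumEFin lee_fin big_mkord.
Qed.

Definition kothe_seminorm m (x : L) : R := fine (kothe_norm a m x).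

Lemma kothe_normE m (x : L) : kothe_norm a m x = (kothe_seminorm m x)%:E.
Proof. by rewrite fineK// kothe_norm_fin. Qed.

Lemma kothe_seminorm_le m (x : L) B :
  (forall n, \sum_(j < n) modulus (kothe_seq x j : K) * a j m <= B) ->
  kothe_seminorm m x <= B.
Proof. by rewrite -lee_fin -kothe_normE; exact: kothe_norm_le. Qed.

Lemma kothe_partial_le m (x : L) n :
  \sum_(j < n) modulus (kothe_seq x j : K) * a j m <= kothe_seminorm m x.
Proof.
rewrite -lee_fin -kothe_normE -sumEFin.
rewrite -(big_mkord xpredT (fun j => (modulus (kothe_seq x j : K) * a j m)%:E)).
by apply: nneseries_lim_ge => j _ _; rewrite lee_fin mulr_ge0 ?modulus_ge0 ?kothe_ge0.
Qed.

Lemma kothe_coord_le m (x : L) j :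
  modulus (kothe_seq x j : K) * a j m <= kothe_seminorm m x.
Proof.
apply: le_trans (kothe_partial_le m x j.+1); rewrite big_ord_recr /= lerDr.
by apply: sumr_ge0 => i _; rewrite mulr_ge0 ?modulus_ge0 ?kothe_ge0.
Qed.

Lemma kothe_fundamental : (forall j, 0 < a j 0%N) -> fundamental kothe_seminorm.
Proof.
move=> a0; split=> [m|m x|x x0|m e e0|V [m [e e0 eV]]].
- split=> [x|x y|c x]; first by rewrite fine_ge0// kothe_norm_ge0.
    by rewrite -lee_fin EFinD -!kothe_normE; exact: kothe_normD.
  by apply: EFin_inj; rewrite EFinM -!kothe_normE; exact: kothe_normZ.
- by rewrite -lee_fin -!kothe_normE; exact: le_kothe_norm.
- apply: val_inj; apply/funext => j /=; apply: modulus_eq0; apply/eqP.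
  rewrite eq_le modulus_ge0 andbT -(ler_pM2r (a0 j)) mul0r -x0.
  exact: kothe_coord_le.
- exists m, e => // x; rewrite /kothe_ball /= subr0.
  by rewrite kothe_normE lte_fin.
- exists m, e => // x /= xe; apply: eV; rewrite /kothe_ball /= subr0.
  by rewrite kothe_normE lte_fin.
Qed.

End kothe.

(** * Nuclear biorthogonal systems *)

Section nuclear_system.
Context {R : realType} {s : scalars}.
Local Notation K := (scalar_field R s).
Context {E : tvsType K} {p : nat -> E -> R}.
Hypotheses (fp : fundamental p) (Ec : tvs_complete E).
Context {e : nat -> E} {f : nat -> E -> K}.
Hypotheses (flin : forall j (a : K) x y, f j (a *: x + y) = a * f j x + f j y)
  (fe : forall i j, f i (e j) = (i == j)%:R)
  (nuc : forall m, exists l D, 0 <= D /\ forall j y,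
    p m (e j) * modulus (f j y) <= D * 2^-1 ^+ j * p l y).

Let sp m : seminorm (p m). Proof. exact: fund_seminorm fp m. Qed.

Let f_on j : linear_on setT (f j). Proof. by move=> a x y _ _; exact: flin. Qed.

Let lT : linear_subspace (@setT E). Proof. by []. Qed.

Let pe j m : 0 < p m (e j).
Proof.
apply: fund_gt0 => //; apply/eqP => e0; have := fe j j; rewrite e0 eqxx => /eqP.
by rewrite (lin0 lT (f_on j)) eq_sym oner_eq0.
Qed.

Definition system_matrix : kothe_matrix R :=
  @KotheMatrix R (fun j m => p m (e j)) (fun j m => semi_ge0 (sp m) (e j))
    (fun j m => fund_leS fp m (e j)) (fun j => ex_intro _ 0%N (pe j 0%N)).

Local Notation a := system_matrix.
Local Notation L := (lambda s a).
Let fl : fundamental (@kothe_seminorm R s a).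
Proof. by apply: kothe_fundamental => j; exact: pe. Qed.

Let synth_ex (xi : L) : exists x : E, series (fun j => (kothe_seq xi j : K) *: e j) @ \oo --> x.
Proof.
apply: (abs_series_cvg fp Ec) => m; exists (kothe_seminorm m xi) => n.
under eq_bigr do rewrite semiZ//.
exact: kothe_partial_le.
Qed.

(** The series has the absolutely summable norms [modulus (xi j) * p m (e j)] that
    define the Koethe space. *)
Lemma synthesis_exists : exists T : {linear L -> E},
  [/\ forall xi : L, series (fun j => (kothe_seq xi j : K) *: e j) @ \oo --> T xi,
      forall m xi, p m (T xi) <= kothe_seminorm m xi & continuous T].
Proof.
have [T0 T0P] := choice synth_ex.
have [|T TE] := @linear_of_fun K L E T0.
  move=> c xi eta; apply: (fund_cvg_unique fp (T0P _)).
  rewrite (_ : series _ = fun n => c *: series (fun j => (kothe_seq xi j : K) *: e j) n +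
    series (fun j => (kothe_seq eta j : K) *: e j) n); first exact: cvg_comb.
  apply/funext => n; rewrite /series /= scaler_sumr -big_split /=.
  by apply: eq_bigr => j _; rewrite scalerA -scalerDl.
have Tcvg xi : series (fun j => (kothe_seq xi j : K) *: e j) @ \oo --> T xi.
  by rewrite TE; exact: T0P.
have Tle m xi : p m (T xi) <= kothe_seminorm m xi.
  apply: (cvg_seminorm_le fp (Tcvg xi)) => n.
  apply: le_trans (series_seminorm_le fp m _ n) _.
  under eq_bigr do rewrite semiZ//.
  exact: kothe_partial_le.
exists T; split=> //; apply: continuous_linear0 => V /(fund_nbhs fp)[m [c c0 cV]].
apply: filterS (fund_ball fl m c0) => xi xic; apply: cV => /=.
exact: le_lt_trans (Tle _ _) xic.
Qed.

(* The Koethe norms of the coordinates of [y] are sums of a geometric series. *)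
Let anal_bound m : exists l D, 0 <= D /\ forall y n,
  \sum_(j < n) modulus (f j y) * p m (e j) <= D * p l y.
Proof.
have [l [D [D0 DP]]] := nuc m; exists l, (2 * D); split=> [|y n].
  by rewrite mulr_ge0.
have p0 := semi_ge0 (sp l) y.
apply: le_trans (_ : \sum_(j < n) D * p l y * 2^-1 ^+ j <= _).
  by apply: ler_sum => j _; rewrite mulrC mulrAC; exact: DP.
by rewrite -mulrA; apply: sum_geometric_half; rewrite mulr_ge0.
Qed.

Let anal_pred y : (fun j => f j y : K^o) \in @kothe_pred R s a.
Proof.
apply/asboolP => m; have [l [D [_ DP]]] := anal_bound m.
by apply: le_lt_trans (@kothe_norm_le R s a m (fun j => f j y) _ (DP y)) _; exact: ltry.
Qed.

Lemma analysis_exists : exists S : {linear E -> L},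
  (forall y j, kothe_seq (S y) j = f j y) /\ continuous S.
Proof.
pose S0 y : L := KotheSpace (anal_pred y).
have [|S SE] := @linear_of_fun K E L S0.
  by move=> c x y; apply: val_inj; apply/funext => j; exact: flin.
exists S; split=> [y j|]; first by rewrite SE.
apply: continuous_linear0 => V /(fund_nbhs fl)[m [c c0 cV]].
have [l [D [D0 DP]]] := anal_bound m.
have d0 : 0 < c / (D + 1) by rewrite divr_gt0// ltr_wpDl.
apply: filterS (fund_ball fp l d0) => y /= yd; apply: cV; rewrite /= SE.
apply: le_lt_trans (@kothe_seminorm_le R s a m (S0 y) _ (DP y)) _.
move: yd; rewrite ltr_pdivlMr ?ltr_wpDl// mulrC; apply: le_lt_trans.
by rewrite ler_wpM2r ?semi_ge0// lerDl.
Qed.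

Let coord_cvg j (v : nat -> E) x c : v @ \oo --> x ->
  (forall n, (j < n)%N -> f j (v n) = c) -> f j x = c.
Proof.
move=> vx vc; have [l [D [D0 DP]]] := nuc 0%N.
apply/eqP; rewrite -subr_eq0; apply/eqP; apply: modulus_eq0; apply/eqP.
rewrite eq_le modulus_ge0 andbT -(ler_pM2l (pe j 0%N)) mulr0.
apply/ler_addgt0Pl => r r0; rewrite addr0.
have d0 : 0 < r / (D + 1) by rewrite divr_gt0// ltr_wpDl.
have [N NP] := (fund_cvgP fp _ _).1 vx l _ d0.
have := NP _ (leq_maxl N j.+1); have := vc _ (leq_maxr N j.+1).
set w := v _ => fw; rewrite -fw -(linB lT (f_on j))// (semi_distC (sp l)).
rewrite ltr_pdivlMr ?ltr_wpDl// => wr; apply: le_trans (DP _ _) _.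
apply: le_trans (ltW wr); rewrite mulrC ler_wpM2l ?semi_ge0//.
apply: ler_wpDr => //; rewrite ler_piMr// exprn_ile1 ?invr_ge0//.
by rewrite invf_le1// ler1n.
Qed.

Let coord_series j (c : nat -> K) n : (j < n)%N ->
  f j (series (fun i => c i *: e i) n) = c j.
Proof.
move=> jn; have -> : f j (series (fun i => c i *: e i) n) = \sum_(i < n) c i * f j (e i).
  rewrite /series /= big_mkord; elim/big_rec2: _ => [|i y x _ <-].
    exact: (lin0 lT (f_on j)).
  by rewrite flin.
rewrite (bigD1 (Ordinal jn))//= fe eqxx mulr1 big1 ?addr0// => i ij.
by rewrite fe eq_sym; move: ij; rewrite -val_eqE /= => /negPf ->; rewrite mulr0.
Qed.

Let unit_partial j n : (j < n)%N -> series (fun i => f i (e j) *: e i) n = e j.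
Proof.
move=> jn; rewrite /series /= big_mkord (bigD1 (Ordinal jn))//= fe eqxx scale1r.
rewrite big1 ?addr0// => i; rewrite -val_eqE /= => ij.
by rewrite fe (negPf ij) scale0r.
Qed.

Let span_range (c : nat -> K) n : closed_span (range e) (series (fun i => c i *: e i) n).
Proof.
apply: subset_closure; exists n, (fun i => c i), (fun i => e i); split.
  by move=> i; exists (i : nat).
by rewrite /series /= big_mkord.
Qed.

(** Analysis followed by synthesis fixes each [e j], hence by continuity the
    closed span; synthesis followed by analysis is the identity coordinatewise. *)
Lemma system_factorization : exists (T : {linear L -> E}) (S : {linear E -> L}),
  [/\ continuous T, continuous S, cancel T S, range T = closed_span (range e) &
    (forall y, closed_span (range e) y -> T (S y) = y) /\
    forall y, series (fun j => f j y *: e j) @ \oo --> T (S y)].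
Proof.
have [T [Tcvg _ Tc]] := synthesis_exists; have [S [SE Sc]] := analysis_exists.
have TScvg y : series (fun j => f j y *: e j) @ \oo --> T (S y).
  rewrite (_ : (fun j => _) = fun j => (kothe_seq (S y) j : K) *: e j) //.
  by apply/funext => j; rewrite SE.
have TSe j : T (S (e j)) = e j.
  apply: (fund_cvg_unique fp (TScvg (e j))); apply/(fund_cvgP fp) => m c c0.
  exists j.+1 => n jn; rewrite unit_partial// subrr semi0//.
have TScl y : closed_span (range e) y -> T (S y) = y.
  pose H : set E := [set y | T (S y) = y].
  have -> : (T (S y) = y) = H y by [].
  apply: (closed_span_min (H := H)) => [||_ [j _ <-]]; last exact: TSe.
    split=> [|c u v Hu Hv]; first by rewrite /H /= !linear0.
    by rewrite /H /= !linearP Hu Hv.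
  move=> z Hz; apply: (fund_eq fp) => c c0; have c2 : 0 < c / 2 by rewrite divr_gt0.
  have TSz : nbhs z [set w | p 0%N (T (S w) - T (S z)) < c / 2].
    have TSc : {for z, continuous (T \o S)} := continuous_comp (Sc z) (Tc (S z)).
    apply: (TSc [set w | p 0%N (w - T (S z)) < c / 2]).
    by apply/(fund_nbhsE fp); exists 0%N, (c / 2).
  have zz : nbhs z [set w | p 0%N (w - z) < c / 2].
    by apply/(fund_nbhsE fp); exists 0%N, (c / 2).
  have [w [Hw [w1 w2]]] := Hz _ (filterI TSz zz).
  apply: le_trans (semiB (sp 0%N) w _ _) _.
  rewrite (splitr c) ltW// ltrD// (semi_distC (sp 0%N)) -{1}Hw.
  exact: w1.
exists T, S; split=> //.
- move=> xi; apply: val_inj; apply/funext => j /=; rewrite SE.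
  by apply: (coord_cvg (Tcvg xi)) => n; exact: coord_series.
- apply/seteqP; split=> [_ [xi _ <-]|y /TScl <-]; last by exists (S y).
  apply: closed_span_closed => V TV; have [N _ NP] := Tcvg xi V TV.
  exists (series (fun j => (kothe_seq xi j : K) *: e j) N); split; last exact: (NP N (leqnn N)).
  exact: span_range.
Qed.

Lemma system_projection : exists P : {linear E -> E},
  [/\ continuous P, forall x, P (P x) = P x, range P = closed_span (range e) &
    forall y, series (fun j => f j y *: e j) @ \oo --> P y].
Proof.
have [T [S [Tc Sc TK Trange [TScl TScvg]]]] := system_factorization.
have [|P PE] := @linear_of_fun K E E (T \o S); first by move=> c x y; rewrite /= !linearP.
exists P; have -> : (P : E -> E) = T \o S by apply/funext.
split=> [x|x||y]; last exact: TScvg.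
- exact: continuous_comp (Sc x) (Tc (S x)).
- by rewrite /= TK.
- apply/seteqP; split=> [_ [y _ <-]|y Gy]; first by rewrite -Trange; exists (S y).
  by exists y => //; exact: TScl.
Qed.

Lemma system_isomorphic : subspace_isomorphic (closed_span (range e)) L.
Proof.
have [T [S [Tc Sc TK Trange _]]] := system_factorization.
by exists T, S; split=> //; exact: continuous_subspaceT.
Qed.

Let unit_partial_le (i m n : nat) :
  \sum_(j < n) modulus ((i == j)%:R : K) * p m (e j) <= p m (e i).
Proof.
have [ni|ni] := leqP n i.
  rewrite big1 ?semi_ge0// => j _; rewrite gtn_eqF ?modulus0 ?mul0r//.
  exact: leq_trans (ltn_ord j) ni.
rewrite (bigD1 (Ordinal ni))//= eqxx modulus1 mul1r big1 ?addr0// => j.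
by rewrite -val_eqE /= eq_sym => /negPf ->; rewrite modulus0 mul0r.
Qed.

Let unit_pred i : (fun j => (i == j)%:R : K^o) \in @kothe_pred R s a.
Proof.
apply/asboolP => m; apply: le_lt_trans (_ : ((p m (e i))%:E < +oo)%E); last exact: ltry.
by apply: kothe_norm_le => n; exact: unit_partial_le.
Qed.

(** The coordinates provide the rank-one maps: by [nuc] applied to the [e j], the
    quotients of the weights at two suitable levels are summable. *)
Lemma system_nuclear : nuclear L.
Proof.
move=> q sq qc.
have [m [C [C0 qC]]] : exists m C, 0 < C /\ forall x : L, q x <= C * kothe_seminorm m x.
  have [|m [C [C0 CP]]] := fund_dominates fl (q := fun _ : unit => q) (fun=> sq).
    have /cvgrPdist_lt/(_ _ ltr01) := qc 0.
    rewrite (semi0 sq); apply: filterS => x /=.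
    by rewrite sub0r normrN ger0_norm ?semi_ge0// => /ltW.
  by exists m, C; split=> // x; exact: CP tt x.
have [l [D [D0 DP]]] := nuc m.
(* The linking seminorm must also dominate [q], hence the maximum. *)
pose h := maxn l m.
have decay j : p m (e j) <= D * 2^-1 ^+ j * p h (e j).
  have := DP j (e j); rewrite fe eqxx modulus1 mulr1 => /le_trans; apply.
  rewrite ler_wpM2l ?fund_le ?leq_maxl// mulr_ge0// exprn_ge0// invr_ge0//.
have sCh : seminorm (fun x : L => C * kothe_seminorm h x).
  have sh := fund_seminorm fl h; split=> [x|x y|c x].
  - by rewrite mulr_ge0 ?(ltW C0)// (semi_ge0 sh).
  - by rewrite -mulrDr ler_wpM2l ?(ltW C0)// (semiD sh).
  - by rewrite (semiZ sh) mulrCA.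
exists (fun x => C * kothe_seminorm h x); split=> //.
- exact: (fund_continuous fl (m := h) (C := C)).
- move=> x; apply: le_trans (qC x) _; rewrite ler_wpM2l ?(ltW C0)//.
  by apply: (fund_le fl); exact: leq_maxr.
have coordZD i (c : K) (x y : L) : (kothe_seq (c *: x + y) i : K^o) =
  c *: (kothe_seq x i : K^o) + (kothe_seq y i : K^o) by [].
have /choice[g gE] i := linear_of_fun (V := L) (W := K^o) (coordZD i).
pose u i : L := KotheSpace (unit_pred i).
exists g, u, (fun i => (C * p h (e i))^-1).
have qu i : q (u i) <= C * p m (e i).
  apply: le_trans (qC _) _; rewrite ler_wpM2l ?(ltW C0)//.
  by apply: kothe_seminorm_le => n; exact: unit_partial_le.
split.
- by move=> i; rewrite invr_ge0 mulr_ge0 ?(ltW C0)// ltW.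
- move=> i x; rewrite gE invfM mulrACA mulVf ?gt_eqF// mul1r mulrC ler_pdivlMr//.
  exact: kothe_coord_le.
- apply: (series_le_cvg (v_ := geometric D 2^-1)).
  + by move=> i; rewrite mulr_ge0 ?semi_ge0// invr_ge0 mulr_ge0 ?(ltW C0)// ltW.
  + by move=> i; rewrite /geometric /= mulr_ge0// exprn_ge0// invr_ge0.
  + move=> i; rewrite mulrC ler_pdivrMr ?mulr_gt0//; apply: le_trans (qu i) _.
    by rewrite mulrCA ler_wpM2l ?(ltW C0)//; exact: decay.
  + apply: is_cvg_geometric_series; rewrite ger0_norm ?invr_ge0//.
    by rewrite invf_lt1// ltr1n.
- move=> x; apply/cvgrPdist_lt => r r0.
  have rC : 0 < r / C by rewrite divr_gt0.
  pose v j := modulus (kothe_seq x j : K) * p m (e j).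
  have v0 j : 0 <= v j by rewrite mulr_ge0 ?modulus_ge0 ?semi_ge0.
  have rC2 : 0 < r / C / 2 by rewrite divr_gt0.
  have [N NP] := bounded_sum_cauchy v0 (kothe_partial_le m x) rC2.
  exists N => // n /= Nn; rewrite sub0r normrN ger0_norm ?semi_ge0//.
  have partE k j : kothe_seq (\sum_(i < k) g i x *: u i) j =
      if (j < k)%N then kothe_seq x j else 0.
    elim: k => [|k IH]; first by rewrite big_ord0.
    have -> : kothe_seq (\sum_(i < k.+1) g i x *: u i) j =
        kothe_seq (\sum_(i < k) g i x *: u i) j + g k x * (k == j)%:R.
      by rewrite big_ord_recr.
    rewrite IH gE ltnS [(j <= k)%N]leq_eqVlt [j == k]eq_sym.
    case: eqVneq => [->|_] /=.
      by rewrite ltnn mulr1 add0r.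
    by rewrite mulr0 addr0.
  apply: le_lt_trans (qC _) _; rewrite mulrC -ltr_pdivlMr//.
  apply: le_lt_trans (_ : r / C / 2 < _); last by rewrite ltr_pdivrMr// ltr_pMr// ltr1n.
  apply: kothe_seminorm_le => M.
  have zv j : modulus (kothe_seq (x - \sum_(i < n) g i x *: u i) j : K) * p m (e j) <=
      if (j < N)%N then 0 else v j.
    have -> : kothe_seq (x - \sum_(i < n) g i x *: u i) j =
      kothe_seq x j - kothe_seq (\sum_(i < n) g i x *: u i) j by [].
    rewrite partE; case: ltnP => jn.
      by rewrite subrr modulus0 mul0r; case: ifP.
    by rewrite subr0 ltnNge (leq_trans Nn jn).
  apply: (@le_trans _ _ (\sum_(j < M) if (j < N)%N then 0 else v j)).
    by apply: ler_sum => j _; exact: zv.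
  have [NM|MN] := leqP N M; last first.
    rewrite big1 ?(ltW rC2)// => j _.
    by rewrite (ltn_trans (ltn_ord j) MN).
  apply/ltW; apply: le_lt_trans (NP M NM); rewrite -(subnKC NM) !big_split_ord /=.
  rewrite [X in _ <= X]addrAC subrr add0r big1 ?add0r => [|j _]; last by rewrite ltn_ord.
  by apply: ler_sum => j _; rewrite ltnNge leq_addr.
Qed.

End nuclear_system.

(** * Sparse subsystems of blocks *)

Lemma infinite_range (nu : nat -> nat) : {homo nu : i j / (i < j)%N} ->
  infinite_set (range nu).
Proof.
move=> numono; apply/infiniteP.
have inj : {in [set: nat] &, injective nu}.
  move=> i j _ _ ij; case: (ltngtP i j) => // /numono; rewrite ij ltnn//.
by have /card_eqPle[_] := inj_card_eq inj.
Qed.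

Lemma nonprincipal_ultrafilter : exists2 U : set_system nat, UltraFilter U &
  forall N, \forall n \near U, (N <= n)%N.
Proof.
have [U [UU ooU]] := ultraFilterLemma eventually_filter.
by exists U => // N; apply: ooU; exists N.
Qed.

Section blocks.
Context {R : realType} {s : scalars}.
Local Notation K := (scalar_field R s).
Context {E : tvsType K} {p : nat -> E -> R}.
Hypothesis fp : fundamental p.
Context {A : nat -> {linear E -> E}}.
Hypotheses (AA : forall m n x, A n (A m x) = if m == n then A n x else 0).

Let sp m : seminorm (p m). Proof. exact: fund_seminorm fp m. Qed.

(** One finite list of sequences spans all blocks at once. Appending sequences that
    already lie in the blocks allows a prescribed vector to be put last, where
    [tame_functional] expects it. *)
Lemma dim_le_spanned k : (forall n, dim_le k (block A n)) ->
  exists bs : seq (nat -> E),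
    forall cs : seq (nat -> E), (forall c n, c \in cs -> block A n (c n)) ->
      forall n, spanned (bs ++ cs) n = block A n.
Proof.
move=> /choice[b bP].
have bA n i : block A n (b n i).
  rewrite bP; exists (fun j => (j == i)%:R); rewrite (bigD1 i)//= eqxx scale1r.
  by rewrite big1 ?addr0// => j /negPf ->; rewrite scale0r.
exists [seq (fun n => b n i) | i <- enum 'I_k] => cs csA n; apply/seteqP; split.
  apply: fspan_sub; first exact: block_subspace.
  move=> _ /mapP[c + ->]; rewrite mem_cat => /orP[/mapP[i _ ->]//|]; exact: csA.
rewrite bP => _ [c ->].
elim/big_ind : _ => [|x y|i _].
- exact/sub0/fspan_subspace.
- exact/subD/fspan_subspace.
apply: subZ; first exact: fspan_subspace.
apply: fspan_mem; apply/mapP; exists (fun n => b n i) => //.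
by rewrite mem_cat; apply/orP; left; apply/mapP; exists i => //; rewrite mem_enum.
Qed.

Section system.
Context {d : nat} {e : nat -> nat -> E} {f : nat -> nat -> E -> K} {nu : nat -> nat}.
Hypotheses (d0 : (0 < d)%N) (numono : {homo nu : i j / (i < j)%N})
  (be : forall r i, (i < d)%N -> block A (nu r) (e i (nu r)))
  (lf : forall r i, (i < d)%N -> linear_on (block A (nu r)) (f i (nu r)))
  (fe : forall r i j, (i < d)%N -> (j < d)%N -> f i (nu r) (e j (nu r)) = (i == j)%:R).

(** The vectors of the selected blocks in one sequence: [j %/ d] is the rank of the
    block and [j %% d] the position in it. *)
Definition flat_vector j : E := e (j %% d) (nu (j %/ d)).
Definition flat_coord j (y : E) : K :=
  f (j %% d) (nu (j %/ d)) (A (nu (j %/ d)) y).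

Let imod j : (j %% d < d)%N. Proof. by rewrite ltn_mod. Qed.

Lemma flat_block j : block A (nu (j %/ d)) (flat_vector j).
Proof. exact/be/imod. Qed.

Lemma flat_coord_linear j (a : K) x y :
  flat_coord j (a *: x + y) = a * flat_coord j x + flat_coord j y.
Proof. by rewrite /flat_coord linearP lf//; [exists x|exists y]. Qed.

Lemma flat_coord_off j n y : n != nu (j %/ d) -> flat_coord j (A n y) = 0.
Proof.
move=> /negPf nj; rewrite /flat_coord AA nj.
exact: (lin0 (block_subspace _) (lf (imod j))).
Qed.

Lemma flat_biorthogonal i j : flat_coord i (flat_vector j) = (i == j)%:R.
Proof.
have [ij|ij] := eqVneq (i %/ d)%N (j %/ d)%N.
  rewrite /flat_coord (block_id AA); last by rewrite ij; exact: flat_block.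
  rewrite /flat_vector ij fe//; congr (nat_of_bool _)%:R.
  apply/eqP/eqP => [mij|->//]; by rewrite (divn_eq i d) (divn_eq j d) ij mij.
rewrite -(block_id AA (flat_block j)) flat_coord_off; last first.
  apply: contra_neq ij => nuij; case: (ltngtP (i %/ d)%N (j %/ d)%N) => //.
    by move/numono; rewrite nuij ltnn.
  by move/numono; rewrite nuij ltnn.
by have [ij'|//] := eqVneq i j; move: ij; rewrite ij' eqxx.
Qed.

(** Only one coordinate block meets [A n y], so the two series agree term by term. *)
Lemma flat_commute (P : E -> E) n : continuous (A n) ->
  (forall y, series (fun j => flat_coord j y *: flat_vector j) @ \oo --> P y) ->
  forall y, P (A n y) = A n (P y).
Proof.
move=> Acn Pcvg y; apply: (fund_cvg_unique fp (Pcvg (A n y))).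
rewrite (_ : series _ = A n \o series (fun j => flat_coord j y *: flat_vector j)).
  exact: (cvg_comp _ _ (Pcvg y) (Acn (P y))).
apply/funext => m; rewrite /series /= linear_sum; apply: eq_bigr => j _.
rewrite linearZ /=; have [nj|nj] := eqVneq n (nu (j %/ d)).
  rewrite [in RHS]nj (block_id AA (flat_block j)); congr (_ *: _).
  by rewrite /flat_coord nj AA eqxx.
rewrite flat_coord_off// (block_orth AA (flat_block j)) ?scale0r ?scaler0//.
by rewrite eq_sym.
Qed.

End system.

Lemma closed_span_eq (G H : set E) : G `<=` closed_span H -> H `<=` closed_span G ->
  closed_span G = closed_span H.
Proof.
move=> GH HG; apply/seteqP.
by split; apply: closed_span_min => //; solve [exact: (closed_span_subspace fp) | exact: closed_span_closed].
Qed.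

Lemma step_subspace_span (x : nat -> E) (M : set nat) :
  (forall n, block A n (x n)) -> step_subspace A (closed_span (x @` M)).
Proof.
move=> bx; split; first exact: (closed_span_subspace fp).
apply: closed_span_eq => [_ [n Mn <-]|y [n _ [Gy _]] //].
by apply: sub_closed_span; exists n => //; split=> //; apply: sub_closed_span; exists n.
Qed.

Lemma zero_subseq_complemented (x : nat -> E) (M : set nat) :
  (forall n, block A n (x n)) -> M !=set0 -> (forall n, M n -> x n = 0) ->
  naturally_complemented A (closed_span (x @` M)).
Proof.
move=> bx [n0 Mn0] x0; split; first exact: step_subspace_span.
have spanE : closed_span (x @` M) = [set 0].
  apply/seteqP; split=> [|_ ->]; last exact/sub0/(closed_span_subspace fp).
  apply: closed_span_min => [||_ [n Mn <-]]; last exact: x0.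
    by split=> // a u v -> ->; rewrite scaler0 addr0.
  move=> u u0; apply: (fund_eq fp) => c c0; rewrite subr0.
  have [_ -> ] := (fund_closureP fp _ _).1 u0 0%N c c0.
  by rewrite sub0r semiN// => /ltW.
exists (\0 : {linear E -> E}); split=> //.
- exact: cst_continuous.
- by rewrite spanE; apply/seteqP; split=> [_ [_ _ <-]|_ ->] //; exists 0.
- by move=> n y /=; rewrite linear0.
Qed.

End blocks.

(** * Complemented subsequences and nuclear block sums *)

Theorem proposition5 (R : realType) (s : scalars)
    (E : tvsType (scalar_field R s)) (k : nat) (A : nat -> {linear E -> E}) :
  frechet E -> montel E -> admits_continuous_norm E ->
  k_fdd k A -> unconditional A ->
  (forall x : nat -> E, (forall n, block A n (x n)) ->
    exists M : set nat, naturally_complemented_subseq A x M) /\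
  (exists M : set nat, infinite_set M /\
    exists a : kothe_matrix R, nuclear (lambda s a) /\
      subspace_isomorphic (block_sum A M) (lambda s a)).
Proof.
move=> EF EM EN [[Ac AA Acvg An0] dimA] _.
have [p fp] := fundamental_exists EF EN; have [_ Ec] := EF.
have {}Ac n : continuous (A n) := (Ac n).1.
have [U UU Uinf] := nonprincipal_ultrafilter.
have [bs bspan] := dim_le_spanned dimA.
split=> [x bx|].
  have [x0|x0] := in_ultra_setVsetC [set n | x n = 0] UU.
    (* Infinitely many [x n] vanish: project onto zero. *)
    have [|nu [numono nux]] := near_subsequence Uinf (Q := fun _ n => x n = 0).
      by move=> _.
    exists (range nu); split; first exact: infinite_range.
    apply: (zero_subseq_complemented fp) => //; first by exists (nu 0%N), 0%N.
    by move=> _ [r _ <-].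
  have {}x0 : \forall n \near U, x n != 0 by apply: filterS x0 => n /eqP.
  have [f [lf fx tf]] := tame_functional fp Uinf bs x0.
  have WA : spanned (rcons bs x) = block A.
    by apply/funext => n; rewrite -cats1 bspan// => c m; rewrite inE => /eqP ->.
  have [//|||nu [numono good nuc]] := nuclear_subsystem fp Ac AA Acvg Uinf (G := fun=> True)
    (d := 1) (e := fun=> x) (f := fun=> f) EM.
  - apply: filterS2 lf fx => n; rewrite WA => lfn fxn; split=> // i j.
    by rewrite !ltnS !leqn0 => /eqP -> /eqP ->; rewrite fxn.
  - by rewrite -WA.
  have be r i : (i < 1)%N -> block A (nu r) (x (nu r)) by [].
  have lfr r : forall i, (i < 1)%N -> linear_on (block A (nu r)) (f (nu r)).
    by have [] := good r.
  have fer r : forall i j, (i < 1)%N -> (j < 1)%N -> f (nu r) (x (nu r)) = (i == j)%:R.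
    by have [] := good r.
  set e := flat_vector (d := 1) (e := fun=> x) (nu := nu).
  set F := flat_coord (A := A) (d := 1) (f := fun=> f) (nu := nu).
  have [P [Pc PP Prange Pcvg]] := system_projection fp Ec (e := e) (f := F)
    (flat_coord_linear (ltn0Sn 0) lfr) (flat_biorthogonal AA (ltn0Sn 0) numono be lfr fer) nuc.
  have eE j : e j = x (nu j) by rewrite /e /flat_vector divn1.
  exists (range nu); split; first exact: infinite_range.
  split; first exact: (step_subspace_span fp).
  exists P; split=> //.
    rewrite Prange; congr closed_span; apply/seteqP; split.
      by move=> _ [j _ <-]; exists (nu j); [exists j|rewrite eE].
    by move=> _ [_ [j _ <-] <-]; exists j.
  move=> n; exact: (flat_commute (e := fun=> x) (f := fun=> f) fp AA (ltn0Sn 0) be lfr (Ac n) Pcvg).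
have [d [e [f [ef tf]]]] := adapted_basis_exists fp Uinf bs.
have WA : spanned bs = block A by apply/funext => n; rewrite -[bs]cats0 bspan.
have d0 : (0 < d)%N.
  rewrite lt0n; apply/eqP => d0; have [n [_ _ _ ye]] := filter_ex ef.
  apply: (negP (An0 n)); apply/eqP/seteqP; split=> [y|_ ->].
    by rewrite -WA => /ye ->; rewrite d0 big_ord0.
  exact/sub0/block_subspace.
have [||nu [numono good nuc]] := nuclear_subsystem fp Ac AA Acvg Uinf
  (G := fun n => forall y, block A n y -> y = \sum_(i < d) f i n y *: e i n)
  (e := e) (f := f) EM d0.
- by apply: filterS ef => n; rewrite WA => -[].
- by rewrite -WA.
have be r : forall i, (i < d)%N -> block A (nu r) (e i (nu r)) by have [] := good r.
have lfr r : forall i, (i < d)%N -> linear_on (block A (nu r)) (f i (nu r)).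
  by have [] := good r.
have fer r : forall i j, (i < d)%N -> (j < d)%N -> f i (nu r) (e j (nu r)) = (i == j)%:R.
  by have [] := good r.
have flin := flat_coord_linear d0 lfr.
have fbi := flat_biorthogonal AA d0 numono be lfr fer.
exists (range nu); split; first exact: infinite_range.
exists (system_matrix fp flin fbi); split; first exact: (system_nuclear nuc).
have -> : block_sum A (range nu) = closed_span (range (flat_vector (d := d) (e := e) (nu := nu))).
  apply: (closed_span_eq fp) => [y [_ [r _ <-]] By|_ [j _ <-]].
    have [ye _ _ _] := good r; rewrite (ye y By).
    elim/big_ind : _ => [|u v|i _].
    - exact/sub0/(closed_span_subspace fp).
    - exact/subD/(closed_span_subspace fp).
    apply: (subZ (closed_span_subspace fp _)).
    apply: sub_closed_span; exists (r * d + i)%N => //.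
    by rewrite /flat_vector modnMDl modn_small// divnMDl// divn_small// addn0.
  by apply: sub_closed_span; exists (nu (j %/ d)%N); [exists (j %/ d)%N|exact: flat_block].
exact: (system_isomorphic fp Ec flin fbi nuc).
Qed.
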